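(* Let $\alpha\in(0,\min\{1,n/2\})$ and let $\varphi:\mathbb R^n\to\mathbb R^n$ be $\eta$-quasisymmetric, with the additional assumption that $J_\varphi,J_{\varphi^{-1}}\in A_\infty(\mathbb R)$ when $n=1$. Then there is a positive constant $C=C(n,\alpha,\eta,[J_\varphi]_{A_\infty(\mathbb R^n)},[J_{\varphi^{-1}}]_{A_\infty(\mathbb R^n)})$ such that, for any precompact open set $\Omega\subset\mathbb R^n$ and any subset $E\Subset\Omega$, $$\operatorname{Cap}_{\mathcal Q_\alpha}(\varphi(E);\varphi(\Omega))\le C\,\|\varphi\|_{\mathscr G_{1-\frac{2\alpha}{n}}}\,\operatorname{Cap}_{\mathcal Q_\alpha}(E;\Omega)$$ (the right-hand side being read as $+\infty$ when $\|\varphi\|_{\mathscr G_{1-\frac{2\alpha}n}}=\infty$). Consequently, if $\|\varphi\|_{\mathscr G_{1-\frac{2\alpha}{n}}}<\infty$ and $E$ is $\mathcal Q_\alpha$-removable in $\Omega$, then $\varphi(E)$ is $\mathcal Q_\alpha$-removable in $\varphi(\Omega)$.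
   Context: **Cubes.** All cubes in $\mathbb R^n$ have sides parallel to the coordinate axes (open, closed or half-open); $\ell(Q)$ is the side length, $|E|$ is Lebesgue measure. For a cube $Q$, $\mathcal D_0(Q)=\{Q\}$, and for $k\in\mathbb N$, $\mathcal D_k(Q)$ is the family of the $2^{kn}$ subcubes of side length $2^{-k}\ell(Q)$ obtained by $k$ successive bisections of each side of $Q$; $\mathcal D(Q)=\bigcup_{k\ge0}\mathcal D_k(Q)$. **$\mathcal Q_\alpha$ seminorm.** $\|f\|_{\mathcal Q_\alpha(\mathbb R^n)}:=\sup_{\text{cubes }Q}\left(|Q|^{\frac{2\alpha}{n}-1}\int_Q\int_Q\frac{|f(x)-f(y)|^2}{|x-y|^{n+2\alpha}}\,dx\,dy\right)^{1/2}\in[0,\infty]$. **Capacity and removability.** Let $\Omega\subset\mathbb R^n$ be a precompact open set; $E\Subset\Omega$ means that the closure of $E$ is compact and contained in $\Omega$. For compact $K\subset\Omega$, $$\operatorname{Cap}_{\mathcal Q_\alpha}(K;\Omega)=\inf\{\|f\|^2_{\mathcal Q_\alpha(\mathbb R^n)}:f\in C_c(\Omega),\ f\ge1\text{ on }K\}$$ ($f$ extended by $0$ outside $\Omega$). For open $O\Subset\Omega$, $\operatorname{Cap}_{\mathcal Q_\alpha}(O;\Omega):=\sup_{K\subset O\text{ compact}}\operatorname{Cap}_{\mathcal Q_\alpha}(K;\Omega)$. For arbitrary $E\Subset\Omega$, $\operatorname{Cap}_{\mathcal Q_\alpha}(E;\Omega):=\inf\{\operatorname{Cap}_{\mathcal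 Q_\alpha}(O;\Omega):O\supset E\text{ open},\ O\Subset\Omega\}$ (consistent with the first definition for compact sets). $E\Subset\Omega$ is $\mathcal Q_\alpha$-removable in $\Omega$ if $\operatorname{Cap}_{\mathcal Q_\alpha}(E;\Omega)=0$. **Quasisymmetric maps.** A homeomorphism $\varphi:\mathbb R^n\to\mathbb R^n$ is $\eta$-quasisymmetric if $\eta:[0,\infty)\to[0,\infty)$ is an increasing homeomorphism with $\eta(0)=0$ and $\frac{|\varphi(x)-\varphi(y)|}{|\varphi(x)-\varphi(z)|}\le\eta\left(\frac{|x-y|}{|x-z|}\right)$ for all distinct $x,y,z$. **Weights and Jacobians.** $A_\infty(\mathbb R^n)$ is the class of weights $w$ (nonnegative, locally integrable) with $[w]_{A_\infty(\mathbb R^n)}:=\sup_Q\left(\frac1{|Q|}\int_Qw\right)\exp\left(-\frac1{|Q|}\int_Q\log w\right)<\infty$. $J_\varphi,J_{\varphi^{-1}}$ are the Jacobians; an assumption $J_\varphi\in A_\infty$ is understood to include $|\varphi(E)|=\int_EJ_\varphi\,dx$ for all measurable $E$ (similarly for $\varphi^{-1}$). For $n\ge2$ quasisymmetry implies (Gehring) that $J_\varphi,J_{\varphi^{-1}}\in A_\infty(\mathbb R^n)$. **Capacity gauge.** For $\beta\in\mathbb R$ and a cube $Q$, let $\mathscr T_\beta(Q)$ be the set of families $\{\lambda_I\}_{I\in\mathcal D(Q)}\subset[0,\infty)$ with $$\sum_{I\in\mathcal D(Q),\,I\supset J}\lambda_I\left(\frac{|I|}{|J|}\cdot\frac{|\varphi^{-1}(J)|}{|\varphi^{-1}(I)|}\right)^\beta\ge1\quad\text{for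 all }J\in\mathcal D(Q),$$ $$\|\varphi\|_{\mathscr G_\beta(Q)}:=\inf_{\{\lambda_I\}\in\mathscr T_\beta(Q)}\sum_{I\in\mathcal D(Q)}\lambda_I\left(\frac{|I|}{|Q|}\right)^\beta,\qquad \|\varphi\|_{\mathscr G_\beta}:=\sup_{\text{cubes }Q\subset\mathbb R^n}\|\varphi\|_{\mathscr G_\beta(Q)}\in[0,\infty].$$ *)

(* Defs.v *)
From HB Require Import structures.
From mathcomp Require Import all_boot all_order all_algebra.
From mathcomp Require Import all_classical all_reals all_analysis.

Set Implicit Arguments.
Unset Strict Implicit.
Unset Printing Implicit Defensive.

Import Order.TTheory GRing.Theory Num.Theory.
Import numFieldNormedType.Exports.

Local Open Scope classical_set_scope.
Local Open Scope ring_scope.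

(* R^n is 'rV[R]_n. Its sigma-algebra is generated by the coordinates (so it  *)
(* is the Borel one), and its Lebesgue measure is the iterated product of     *)
(* lebesgue_measure, starting from the unit mass on the point R^0.            *)

Definition rV_display : measure_display. Proof. exact: default_measure_display. Qed.

Section rV_measurable.
Context (R : realType) (n : nat).

Definition rV_coord (i : 'I_n) (x : 'rV[R]_n) : measurableTypeR R := x 0 i.

Let rV_set0 : g_sigma_preimage rV_coord set0.
Proof. exact: sigma_algebra0. Qed.

Let rV_setC A : g_sigma_preimage rV_coord A -> g_sigma_preimage rV_coord (~` A).
Proof. exact: sigma_algebraC. Qed.

Let rV_bigcup (F : _^nat) :
  (forall i, g_sigma_preimage rV_coord (F i)) ->
  g_sigma_preimage rV_coord (\bigcup_i (F i)).
Proof. exact: sigma_algebra_bigcup. Qed.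

HB.instance Definition _ := @isMeasurable.Build rV_display 'rV[R]_n
  (g_sigma_preimage rV_coord) rV_set0 rV_setC rV_bigcup.

End rV_measurable.

Definition rV_cons (R : realType) (n : nat)
  (p : measurableTypeR R * 'rV[R]_n) : 'rV[R]_n.+1 :=
  \row_i (if unlift ord0 i is Some j then p.2 0 j else p.1 : R).

Definition rV_uncons (R : realType) (n : nat) (x : 'rV[R]_n.+1) :
  measurableTypeR R * 'rV[R]_n := (x 0 ord0, \row_i x 0 (lift ord0 i)).

Section rV_cons_lemmas.
Context (R : realType) (n : nat).

Lemma rV_consK : cancel (@rV_cons R n) (@rV_uncons R n).
Proof.
move=> [a x]; rewrite /rV_uncons !mxE unlift_none; congr pair.
by apply/rowP => i; rewrite !mxE liftK.
Qed.

Lemma measurable_rV_coord (i : 'I_n) : measurable_fun setT (@rV_coord R n i).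
Proof.
move=> _ B mB; rewrite setTI; apply: sub_sigma_algebra.
by rewrite (bigD1 i) //=; left; exists B; rewrite ?setTI.
Qed.

Lemma measurable_fun_rVP d (T : measurableType d) (f : T -> 'rV[R]_n) :
  (forall i, measurable_fun setT (@rV_coord R n i \o f)) ->
  measurable_fun setT f.
Proof.
move=> mf.
apply: (@measurability _ _ _ _ _ _
  (\big[setU/set0]_(i < n)
     preimage_set_system setT (@rV_coord R n i) measurable)) => //.
move=> _ [A + <-]; rewrite setTI => mA.
have {mA} : exists (i : 'I_n) (B : set (measurableTypeR R)),
    measurable B /\ A = @rV_coord R n i @^-1` B.
  move: mA; elim/big_ind : _ => //=.
  - by move=> X Y HX HY [/HX|/HY].
  - by move=> i _ [B mB <-]; exists i, B; rewrite setTI.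
move=> [i [B [mB ->]]]; rewrite -comp_preimage -[X in measurable X]setTI.
exact: mf.
Qed.

End rV_cons_lemmas.

Section rV_cons_measurable.
Context (R : realType) (n : nat).

Lemma measurable_rV_cons : measurable_fun setT (@rV_cons R n).
Proof.
apply: measurable_fun_rVP => i; case: (unliftP ord0 i) => [j ->|->].
  rewrite (_ : _ \o _ = @rV_coord R n j \o snd).
    by apply: measurableT_comp => //; exact: measurable_rV_coord.
  by apply/funext => p /=; rewrite /rV_coord mxE liftK.
rewrite (_ : _ \o _ = fst); first exact: measurable_fst.
by apply/funext => p /=; rewrite /rV_coord mxE unlift_none.
Qed.

Lemma measurable_rV_uncons : measurable_fun setT (@rV_uncons R n).
Proof.
apply/measurable_fun_pairP; split; first exact: (@measurable_rV_coord R n.+1 ord0).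
apply: measurable_fun_rVP => i.
rewrite (_ : _ \o _ = @rV_coord R n.+1 (lift ord0 i)).
  exact: measurable_rV_coord.
by apply/funext => x; rewrite /rV_coord /= mxE.
Qed.

End rV_cons_measurable.

Section lebesgue_succ.
Context (R : realType) (n : nat).
Variable m : {sigma_finite_measure set 'rV[R]_n -> \bar R}.

Definition lebesgue_succ : set 'rV[R]_n.+1 -> \bar R :=
  pushforward (@lebesgue_measure R \x m)%E (@rV_cons R n).

Let lebesgue_succ0 : lebesgue_succ set0 = 0%E.
Proof. by rewrite /lebesgue_succ /pushforward preimage_set0 measure0. Qed.

Let lebesgue_succ_ge0 A : (0 <= lebesgue_succ A)%E.
Proof. by rewrite /lebesgue_succ /pushforward; apply: measure_ge0. Qed.

Let lebesgue_succ_sigma_additive : semi_sigma_additive lebesgue_succ.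
Proof.
move=> F mF tF mUF; rewrite /lebesgue_succ /pushforward preimage_bigcup.
have mpre A : measurable A -> measurable (@rV_cons R n @^-1` A).
  by move=> mA; rewrite -[X in measurable X]setTI; exact: measurable_rV_cons.
apply: measure_semi_sigma_additive.
- by move=> k; apply: mpre; exact: mF.
- apply/trivIsetP => /= i j _ _ ij; rewrite -preimage_setI.
  by move/trivIsetP : tF => /(_ _ _ _ _ ij) ->//; rewrite preimage_set0.
- by rewrite -preimage_bigcup; exact: mpre.
Qed.

HB.instance Definition _ := isMeasure.Build _ _ _ lebesgue_succ
  lebesgue_succ0 lebesgue_succ_ge0 lebesgue_succ_sigma_additive.

Let lebesgue_succ_sigma_finite : sigma_finite setT lebesgue_succ.
Proof.
have /sigma_finiteP[F [TF ndF Foo]] := sigma_finiteT (@lebesgue_measure R).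
have /sigma_finiteP[G [TG ndG Goo]] := sigma_finiteT m.
exists (fun k => @rV_uncons R n @^-1` (F k `*` G k)).
  rewrite -preimage_bigcup [X in _ @^-1` X](_ : _ = setT) ?preimage_setT//.
  rewrite -setXTT TF TG predeqE => -[x y]; split.
    by move=> [k _ []/= ? ?]; split; exists k.
  move=> [/= [i _ Fix] [j _ Gjy]]; exists (maxn i j) => //; split.
  - by move: x Fix; exact/subsetPset/ndF/leq_maxl.
  - by move: y Gjy; exact/subsetPset/ndG/leq_maxr.
move=> k; have [mF ?] := Foo k; have [mG ?] := Goo k; split.
  rewrite -[X in measurable X]setTI; apply: measurable_rV_uncons => //.
  exact: measurableX.
rewrite /lebesgue_succ /pushforward -comp_preimage.
rewrite (_ : _ \o _ = id); last by apply/funext => p /=; rewrite rV_consK.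
by rewrite preimage_id product_measure1E// lte_mul_pinfty// ge0_fin_numE.
Qed.

HB.instance Definition _ := Measure_isSigmaFinite.Build _ _ _ lebesgue_succ
  lebesgue_succ_sigma_finite.

End lebesgue_succ.

Fixpoint lebesgue_rV (R : realType) (n : nat) :
    {sigma_finite_measure set 'rV[R]_n -> \bar R} :=
  if n is k.+1 then lebesgue_succ (lebesgue_rV R k) else \d_(0 : 'rV[R]_0).

Definition volume (R : realType) (n : nat) (A : set 'rV[R]_n) : R :=
  fine (lebesgue_rV R n A).

Section cubes.
Context (R : realType) (n : nat).

(* The pair (c, l) with 0 < l encodes the half-open cube c + [0, l)^n. Open   *)
(* and closed cubes would give the same quantities below, as faces and their  *)
(* images under absolutely continuous homeomorphisms carry no mass.           *)
Definition cube : Type := ('rV[R]_n * R)%type.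

Definition cubes : set cube := [set Q | 0 < Q.2].

Definition cube_set (Q : cube) : set 'rV[R]_n :=
  [set x | forall i, Q.1 0 i <= x 0 i < Q.1 0 i + Q.2].

Definition bisect (Q : cube) : set cube :=
  [set (Q.1 + (Q.2 / 2) *: (\row_i (e i)%:R), Q.2 / 2)
     | e in [set: {ffun 'I_n -> bool}]].

Fixpoint dyadic_gen (k : nat) (Q : cube) : set cube :=
  if k is j.+1 then \bigcup_(I in dyadic_gen j Q) bisect I else [set Q].

Definition dyadic (Q : cube) : set cube := \bigcup_k dyadic_gen k Q.

End cubes.

Section capacity.
Context (R : realType) (n : nat) (alpha : R).
Implicit Types (f : 'rV[R]_n -> R) (K O E Omega : set 'rV[R]_n).
Local Notation mu := (lebesgue_rV R n).

Definition enorm (x : 'rV[R]_n) : R := Num.sqrt (\sum_i x 0 i ^+ 2).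

(* On the null set x = y the integrand is 0, because 0^-1 = 0.                *)
Definition Qnorm f : \bar R :=
  ereal_sup [set sqrte
    ((volume (cube_set Q) `^ (2 * alpha / n%:R - 1))%:E *
     \int[mu]_(x in cube_set Q) \int[mu]_(y in cube_set Q)
       (`|f x - f y| ^+ 2 / enorm (x - y) `^ (n%:R + 2 * alpha))%:E)%E
    | Q in @cubes R n].

Definition compactly_contained E Omega :=
  compact (closure E) /\ closure E `<=` Omega.

(* The extensions by 0 to R^n of the functions of C_c(Omega).                 *)
Definition Cc Omega : set ('rV[R]_n -> R) :=
  [set f | continuous f /\ compactly_contained [set x | f x != 0] Omega].

Definition cap_compact K Omega : \bar R :=
  ereal_inf [set (Qnorm f ^+ 2)%E
    | f in [set f | Cc Omega f /\ forall x, K x -> 1 <= f x]].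

Definition cap_open O Omega : \bar R :=
  ereal_sup [set cap_compact K Omega | K in [set K | compact K /\ K `<=` O]].

Definition cap E Omega : \bar R :=
  ereal_inf [set cap_open O Omega
    | O in [set O | [/\ open O, E `<=` O & compactly_contained O Omega]]].

Definition removable E Omega :=
  compactly_contained E Omega /\ cap E Omega = 0%E.

End capacity.

(* A continuous increasing bijection of [0, +oo[ has a continuous inverse.    *)
Definition increasing_homeo (R : realType) (eta : R -> R) :=
  [/\ set_bij `[0, +oo[ `[0, +oo[ eta, {within `[0, +oo[, continuous eta},
      {in `[0, +oo[ &, {homo eta : s t / s < t}} & eta 0 = 0].

Section quasisymmetric.
Context (R : realType) (n : nat).
Implicit Types (phi psi : 'rV[R]_n -> 'rV[R]_n).
Local Notation mu := (lebesgue_rV R n).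

(* psi is the inverse of phi.                                                 *)
Definition homeomorphism phi psi :=
  [/\ cancel phi psi, cancel psi phi, continuous phi & continuous psi].

Definition quasisymmetric (eta : R -> R) phi psi :=
  [/\ homeomorphism phi psi, increasing_homeo eta &
      forall x y z, x != y -> x != z -> y != z ->
        enorm (phi x - phi y) / enorm (phi x - phi z)
          <= eta (enorm (x - y) / enorm (x - z))].

Definition locally_integrable_rV (w : 'rV[R]_n -> R) :=
  measurable_fun setT w /\
  forall K, compact K -> (\int[mu]_(x in K) `|w x|%:E < +oo)%E.

(* lne 0 = -oo, so that w vanishing on a set of positive measure gives +oo.   *)
Definition Ainfty_const (w : 'rV[R]_n -> R) : \bar R :=
  ereal_sup [set
    ((volume (cube_set Q))^-1%:E * (\int[mu]_(x in cube_set Q) (w x)%:E) *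
     expeR (- ((volume (cube_set Q))^-1%:E *
               \int[mu]_(x in cube_set Q) lne (w x)%:E)))%E
    | Q in @cubes R n].

Definition Ainfty (w : 'rV[R]_n -> R) :=
  [/\ forall x, 0 <= w x, locally_integrable_rV w & (Ainfty_const w < +oo)%E].

(* The value at points of non-differentiability is a convention.              *)
Definition Jac phi (x : 'rV[R]_n) : R :=
  if `[< differentiable phi x >] then `|\det (jacobian phi x)| else 0.

(* Stated for Borel sets E; it then extends to Lebesgue measurable ones, since *)
(* it makes phi map Borel null sets to null sets.                             *)
Definition Jac_Ainfty phi :=
  Ainfty (Jac phi) /\
  forall E, measurable E -> mu (phi @` E) = (\int[mu]_(x in E) (Jac phi x)%:E)%E.

Definition gauge_admissible phi (beta : R) (Q : cube R n) :
    set (cube R n -> R) :=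
  [set lambda | (forall I, dyadic Q I -> 0 <= lambda I) /\
    forall J, dyadic Q J ->
      (1 <= \esum_(I in [set I | dyadic Q I /\ cube_set J `<=` cube_set I])
        (lambda I *
         (volume (cube_set I) / volume (cube_set J) *
          (volume (phi @^-1` cube_set J) / volume (phi @^-1` cube_set I)))
           `^ beta)%:E)%E].

Definition gauge_on phi (beta : R) (Q : cube R n) : \bar R :=
  ereal_inf [set (\esum_(I in dyadic Q)
      (lambda I * (volume (cube_set I) / volume (cube_set Q)) `^ beta)%:E)%E
    | lambda in gauge_admissible phi beta Q].

Definition gauge phi (beta : R) : \bar R :=
  ereal_sup [set gauge_on phi beta Q | Q in @cubes R n].

End quasisymmetric.

(* Main.v *)
(* Write psi for the inverse of phi and beta = 1 - 2 alpha / n. The estimate is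
   |f o psi|^2 <= C |phi|_G |f|^2 for the Q_alpha seminorms of continuous f; the
   capacities then compare because f |-> f o psi maps the competitors for (K, Omega)
   to competitors for (phi(K), phi(Omega)).
   For a dyadic cube J let S(J) be the mean square oscillation of f over psi(J)
   with respect to Lebesgue measure. By quasisymmetry psi(J) lies between two
   concentric balls of comparable radii and |psi(J)| decreases geometrically along
   chains of dyadic cubes, hence
     sum_(J subset I) |psi(J)|^beta S(J) <= C |psi(I)|^beta |f|^2,
   because the sum of |psi(J)|^(beta - 2) over the J with x, y in psi(J) is
   dominated by its last term, at most C |x - y|^(- n - 2 alpha). Inserting the
   admissibility condition of the gauge in each term and exchanging the sums gives
     sum_(J in D(Q)) |J|^beta S(J) <= C |phi|_G |Q|^beta |f|^2.
   Conversely the energy of u = f o psi on a cube is controlled by such sums over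
   finitely many shifted cubes: u is continuous, so u(x) is at every point the
   limit of its values at suitable base points of the dyadic cubes around x, whose
   successive differences are bounded by S. This telescoping is pointwise, so that
   averages with respect to the image of Lebesgue measure under psi never occur. *)
Require Import Defs.
From HB Require Import structures.
From mathcomp Require Import all_boot all_order all_algebra.
From mathcomp Require Import all_classical all_reals all_analysis.
From mathcomp Require Import measurable_realfun ring lra zify.

Set Implicit Arguments.
Unset Strict Implicit.
Unset Printing Implicit Defensive.

Import Order.TTheory GRing.Theory Num.Theory.
Import numFieldNormedType.Exports.

Local Open Scope classical_set_scope.
Local Open Scope ring_scope.

(** * Borel sets and cubes in R^n *)

Section rV_borel.
Context (R : realType) (n : nat).
Implicit Types (x : 'rV[R]_n) (e : R).

Lemma ball_rVP x e y : 0 < e ->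
  ball x e y <-> forall i, `|x 0 i - y 0 i| < e.
Proof.
move=> e0; split=> [[_ h] i|h]; first exact: h.
by split=> // i j; rewrite (ord1 i); exact: h.
Qed.

Lemma measurable_rV_bigcap (P : 'I_n -> set R) :
  (forall i, measurable (P i : set (measurableTypeR R))) ->
  measurable [set x : 'rV[R]_n | forall i, P i (x 0 i)].
Proof.
move=> mP; rewrite (_ : [set x | _] =
    \bigcap_(i in [set: 'I_n]) (@rV_coord R n i @^-1` P i)); last first.
  by apply/seteqP; split=> x /= h i; [move=> _|]; exact: h.
apply: fin_bigcap_measurable => // i _.
by rewrite -[X in measurable X]setTI; apply: measurable_rV_coord.
Qed.

Lemma measurable_ball_rV x e : measurable (ball x e).
Proof.
have [e0|e0] := ltP 0 e; last first.
  by rewrite (_ : ball x e = set0)// -subset0 => y [e0']; have := lt_le_trans e0' e0; rewrite ltxx.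
rewrite (_ : ball x e = [set y | forall i, ball (x 0 i) e (y 0 i)]).
  apply: (@measurable_rV_bigcap (fun i => ball (x 0 i) e)) => i.
  by rewrite ball_itv; exact: measurable_itv.
by apply/seteqP; split=> y /(ball_rVP _ _ e0).
Qed.

(** The sigma-algebra is generated by the coordinates, hence contains the sup-norm balls. An open
    set is the union of the countably many balls with rational centre and radius [1 / (k + 1)] that
    it contains. *)
Lemma open_measurable_rV (U : set 'rV[R]_n) : open U -> measurable U.
Proof.
move=> oU.
pose B (p : 'rV[rat]_n * nat) : set 'rV[R]_n :=
  ball (map_mx (@ratr R) p.1 : 'rV[R]_n) (p.2.+1%:R^-1).
(* The pairs of a centre and an index are enumerated by natural numbers; non-codes and balls leaving
   [U] contribute the empty set. *)
pose F k := if unpickle k is Some p then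
   if `[< B p `<=` U >] then B p else set0 else set0.
rewrite (_ : U = \bigcup_k F k).
  apply: bigcupT_measurable => k; rewrite /F.
  by case: unpickle => // p; case: ifPn => // _; exact: measurable_ball_rV.
apply/seteqP; split=> [x Ux|x [k _]]; last first.
  by rewrite /F; case: unpickle => // p; case: asboolP => // BU /BU.
have /nbhs_ballP[e /= e0 xeU] : nbhs x U by apply: open_nbhs_nbhs.
have [k ke] : exists k, k.+1%:R^-1 < e / 2.
  have [k] := @ltr_add_invr R 0 (e / 2) ltac:(by rewrite divr_gt0).
  by rewrite add0r => ?; exists k.
have k0 : (0 : R) < k.+1%:R^-1 by rewrite invr_gt0.
have /choice[q qP] (i : 'I_n) : exists q : rat, `|ratr q - x 0 i| < k.+1%:R^-1.
  have /rat_in_itvoo[q] : x 0 i - k.+1%:R^-1 < x 0 i + k.+1%:R^-1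
    by rewrite ltrBlDr -addrA ltrDl addr_gt0.
  by rewrite in_itv/= => /andP[q1 q2]; exists q; rewrite ltr_distl q1 q2.
pose p := (\row_i q i, k).
exists (pickle p) => //; rewrite /F pickleK.
have Bx : B p x.
  by apply/ball_rVP => // i; rewrite !mxE; exact: qP.
rewrite asboolT// => y By.
apply: xeU; rewrite [e]splitr; apply: (@ball_triangle _ _ (map_mx (@ratr R) p.1)).
  by apply: ball_sym; apply: le_ball Bx; exact: ltW.
by apply: le_ball By; exact: ltW.
Qed.

Lemma continuous_measurable_rV (f : 'rV[R]_n -> R) :
  continuous f -> measurable_fun setT (f : _ -> measurableTypeR R).
Proof.
move=> cf; apply: (measurability _ (RGenOInfty.measurableE R)) => //.
move=> _ [_ [a ->] <-]; rewrite setTI; apply: open_measurable_rV.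
by apply: open_comp => [x _|]; [exact: cf|exact: rray_open].
Qed.

End rV_borel.

Lemma continuous_measurable_rV_rV (R : realType) (n m : nat)
    (f : 'rV[R]_n -> 'rV[R]_m) : continuous f -> measurable_fun setT f.
Proof.
move=> cf; apply: measurable_fun_rVP => i; apply: continuous_measurable_rV.
by move=> x; apply: continuous_comp; [exact: cf|exact: coord_continuous].
Qed.

Lemma measurable_cube_set (R : realType) (n : nat) (Q : cube R n) :
  measurable (cube_set Q).
Proof.
rewrite (_ : cube_set Q =
  [set x | forall i, `[Q.1 0 i, Q.1 0 i + Q.2[%classic (x 0 i)]).
  apply: (@measurable_rV_bigcap _ _ (fun i => `[Q.1 0 i, Q.1 0 i + Q.2[%classic)) => i.
  exact: measurable_itv.
by apply/seteqP; split=> x h i; have := h i; rewrite /= in_itv.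
Qed.

(** By induction on the dimension: [rV_cons] pulls the cube back to an interval times a cube of one
    dimension less. In dimension 0 the Dirac mass gives the empty power 1. *)
Lemma lebesgue_rV_cube (R : realType) (n : nat) (Q : cube R n) : 0 < Q.2 ->
  lebesgue_rV R n (cube_set Q) = (Q.2 ^+ n)%:E.
Proof.
elim: n Q => [|n IH] [c l] /= l0.
  rewrite /= diracE mem_set// => i.
  by case: i.
rewrite /lebesgue_succ /pushforward /=.
rewrite (_ : _ @^-1` _ = `[c 0 0, c 0 0 + l[%classic `*`
    cube_set (\row_i c 0 (lift ord0 i), l)).
  rewrite product_measure1E//=; last 1 first.
    exact: measurable_cube_set.
  rewrite IH//= lebesgue_measure_itv/= lte_fin ltrDl l0.
  by rewrite -EFinD -EFinM exprS; congr (_ * _)%:E; rewrite addrC addKr.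
apply/seteqP; split=> [[a x] /= h|[a x] /= [h1 h2] i].
  split=> [|i /=].
    by have := h ord0; rewrite mxE unlift_none in_itv.
  by have := h (lift ord0 i); rewrite !mxE liftK.
rewrite mxE; case: (unliftP ord0 i) => [j ->|->]; last by move: h1; rewrite in_itv.
by have := h2 j; rewrite /= mxE.
Qed.

Lemma volume_cube (R : realType) (n : nat) (Q : cube R n) : 0 < Q.2 ->
  volume (cube_set Q) = Q.2 ^+ n.
Proof. by move=> Q0; rewrite /volume lebesgue_rV_cube. Qed.

(** * Sums over countable sets and integrals *)

Section esum_complements.
Local Open Scope ereal_scope.
Context (R : realType).

Lemma esum_subset (T : choiceType) (A B : set T) (a : T -> \bar R) :
  A `<=` B -> \esum_(i in A) a i <= \esum_(i in B) a i.
Proof.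
move=> AB; apply: ge_ereal_sup => _ [X [finX XA] <-].
by apply: ereal_sup_ubound; exists X => //; split=> //; exact: subset_trans AB.
Qed.

(** Serves for sums with indicators: terms of the left sum that vanish may lie outside the index set
    of the right one. *)
Lemma le_esum_support (T : choiceType) (A B : set T) (a b : T -> \bar R) :
  (forall i, B i -> 0 <= b i) ->
  (forall i, A i -> a i <= 0 \/ B i /\ a i <= b i) ->
  \esum_(i in A) a i <= \esum_(i in B) b i.
Proof.
move=> b0 ab; rewrite (esum_mkcond A) (esum_mkcond B); apply: le_esum => i _.
case: ifPn => [/[!inE] /ab[ai|[Bi abi]]|_].
- by apply: le_trans ai _; case: ifPn => // /[!inE] /b0.
- by rewrite mem_set.
- by case: ifPn => // /[!inE] /b0.
Qed.

(** Tonelli for sums: both sides run over the pairs related by [r], and swapping the components is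
    the bijection. *)
Lemma esum_exchange_dep (T1 T2 : choiceType) (A : set T1) (B : set T2)
    (r : T1 -> T2 -> Prop) (a : T1 -> T2 -> \bar R) :
  (forall i j, A i -> B j -> 0 <= a i j) ->
  \esum_(i in A) \esum_(j in [set j | B j /\ r i j]) a i j =
  \esum_(j in B) \esum_(i in [set i | A i /\ r i j]) a i j.
Proof.
move=> a0; rewrite !esum_esum//; last 2 first.
- by move=> i j Ai [Bj _]; exact: a0.
- by move=> j i Bj [Ai _]; exact: a0.
pose sw (p : T2 * T1) := (p.2, p.1).
rewrite (@reindex_esum _ _ _
  (B `*`` (fun j => [set i | A i /\ r i j])) _ sw)//; split.
- by move=> [i j] [/= ? [? ?]].
- by move=> [i j] [i' j'] _ _ [-> ->].
- by move=> [i j] [/= ? [? ?]]; exists (j, i).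
Qed.

Lemma esumZl (T : choiceType) (A : set T) (k : R) (a : T -> \bar R) :
  (0 <= k)%R -> (forall i, A i -> 0 <= a i) ->
  \esum_(i in A) (k%:E * a i) = k%:E * \esum_(i in A) a i.
Proof.
rewrite le_eqVlt => /predU1P[<-|k0] a0.
  by rewrite mul0e esum1// => i _; rewrite mul0e.
(* Finite partial sums give one inequality for every positive constant; the other follows from it
   with the constant [k^-1]. *)
have le c (b : T -> \bar R) : (0 < c)%R -> (forall i, A i -> 0 <= b i) ->
    \esum_(i in A) (c%:E * b i) <= c%:E * \esum_(i in A) b i.
  move=> c0 b0; apply: ge_ereal_sup => _ [X [finX XA] <-].
  rewrite fsbig_finite//= big_seq -ge0_sume_distrr; last first.
    by move=> i; rewrite in_fset_set// inE => /XA /b0.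
  rewrite lee_pmul2l// -big_seq -fsbig_finite//.
  by apply: ereal_sup_ubound; exists X.
apply/eqP; rewrite eq_le le//=.
rewrite -lee_pdivlMl// (eq_esum (b := fun i => k^-1%:E * (k%:E * a i))).
  apply: le => [|i Ai]; first by rewrite invr_gt0.
  by apply: mule_ge0; [rewrite lee_fin ltW|exact: a0].
by move=> i _; rewrite muleA -EFinM mulVf ?mul1e// gt_eqF.
Qed.

End esum_complements.

Section integral_esum.
Local Open Scope ereal_scope.
Context d (T : measurableType d) (R : realType) (mu : {measure set T -> \bar R}).
Context (I : choiceType) (A : set I) (D : set T) (f : I -> T -> \bar R).
Hypothesis mD : measurable D.
Hypothesis cA : countable A.
Hypothesis mf : forall i, A i -> measurable_fun D (f i).
Hypothesis f0 : forall i x, A i -> D x -> 0 <= f i x.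

(** Turns a sum over a countable set into a series over the natural numbers, where monotone
    convergence applies. Numbers outside the image of the injection are sent to [None] and
    contribute 0. *)
Let enum : exists g : nat -> option I,
  (forall h : I -> \bar R, (forall i, A i -> 0 <= h i) ->
    \esum_(i in A) h i = \sum_(k <oo) oapp h 0 (g k)) /\
  forall k i, g k = Some i -> A i.
Proof.
have /pcard_injP[e einj] := cA.
pose g k := if pselect (exists2 i, A i & e i = k) is left P
                 then Some (projT1 (cid2 P)) else None.
exists g; split=> [h h0|k i]; last first.
  by rewrite /g; case: pselect => // P [<-]; case: cid2.
have gs i : A i -> g (e i) = Some i.
  move=> Ai; rewrite /g; case: pselect => [P|[]]; last by exists i.
  by case: cid2 => j Aj /= eji; congr Some; apply: einj; rewrite ?inE.
have g0 k : 0 <= oapp h 0 (g k).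
  by rewrite /g; case: pselect => //= P; case: cid2 => j /= /h0.
rewrite nneseries_esumT//.
rewrite (eq_esum (b := fun i => oapp h 0 (g (e i)))); last first.
  by move=> i Ai; rewrite gs.
rewrite -(@esum_image _ _ _ A e (fun k => oapp h 0 (g k)))//.
rewrite esum_mkcond; apply: eq_esum => k _.
case: ifPn => //; rewrite notin_setE => ek; rewrite /g.
by case: pselect => // -[i Ai eik]; exfalso; apply: ek; exists i.
Qed.

Lemma emeasurable_fun_esum : measurable_fun D (fun x => \esum_(i in A) f i x).
Proof.
have [g [gE gA]] := enum.
apply: (eq_measurable_fun (fun x => \sum_(k <oo) oapp (f ^~ x) 0 (g k))).
  by move=> x /[!inE] Dx; rewrite gE// => i Ai; exact: f0.
apply: ge0_emeasurable_sum => k.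
  by move=> x Dx _; case gk: (g k) => [i|]//=; apply: f0 => //; exact: gA gk.
by case gk: (g k) => [i|]//= _; apply: mf; exact: gA gk.
Qed.

Lemma ge0_integral_esum :
  \int[mu]_(x in D) (\esum_(i in A) f i x) = \esum_(i in A) \int[mu]_(x in D) f i x.
Proof.
have [g [gE gA]] := enum.
rewrite (eq_integral (fun x => \sum_(k <oo) oapp (f ^~ x) 0 (g k))); last first.
  by move=> x /[!inE] Dx; rewrite gE// => i Ai; exact: f0.
rewrite integral_nneseries//; last 2 first.
- by move=> k; case gk: (g k) => [i|]//=; apply: mf; exact: gA gk.
- by move=> k x Dx; case gk: (g k) => [i|]//=; apply: f0 => //; exact: gA gk.
rewrite gE; last by move=> i Ai; apply: integral_ge0 => x; exact: f0.
apply: eq_eseriesr => k _; case: (g k) => [i|]//=.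
by rewrite integral0.
Qed.

End integral_esum.

Section integral_prod.
Local Open Scope ereal_scope.
Context d1 d2 (T1 : measurableType d1) (T2 : measurableType d2) (R : realType).
Context (m1 : {sigma_finite_measure set T1 -> \bar R}).
Context (m2 : {sigma_finite_measure set T2 -> \bar R}).

(** Tonelli on the whole space, applied to the extension of [f] by 0 outside the product set. *)
Lemma integral_setX (A : set T1) (B : set T2) (f : T1 * T2 -> \bar R) :
  measurable A -> measurable B -> measurable_fun setT f -> (forall z, 0 <= f z) ->
  \int[m1]_(x in A) \int[m2]_(y in B) f (x, y) =
  \int[m1 \x m2]_(z in A `*` B) f z.
Proof.
move=> mA mB mf f0; rewrite [RHS]integral_mkcond fubini_tonelli1; last 2 first.
- apply/(measurable_restrictT _ _).1; first exact: measurableX.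
  exact: measurable_funTS.
- by move=> z; apply: erestrict_ge0.
rewrite integral_mkcond; apply: eq_integral => x _; rewrite /fubini_F patchE.
case: ifPn => xA.
  rewrite [LHS]integral_mkcond; apply: eq_integral => y _; rewrite !patchE.
  by rewrite in_setX xA.
rewrite integral0_eq// => y _; rewrite patchE in_setX.
by rewrite (negbTE xA).
Qed.

End integral_prod.

(** * Dyadic cubes *)

Section dyadic_chain.
Context (R : realType) (n : nat).
Implicit Types (Q I J : cube R n) (x y : 'rV[R]_n).

(** In each coordinate the half on the side of [x] is taken. This is a child of [Q] for every [x],
    and it contains [x] when [Q] does. *)
Definition dyadic_child Q x : cube R n :=
  (Q.1 + (Q.2 / 2) *: (\row_i (Q.1 0 i + Q.2 / 2 <= x 0 i)%R%:R), Q.2 / 2).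

Definition dyadic_chain Q x k : cube R n := iter k (fun J => dyadic_child J x) Q.

Lemma bisect_side Q J : bisect Q J -> J.2 = Q.2 / 2.
Proof. by case=> e _ <-. Qed.

Lemma bisect_sub Q J : 0 < Q.2 -> bisect Q J -> cube_set J `<=` cube_set Q.
Proof.
move=> Q0 [e _ <-] x Jx i; have := Jx i; rewrite /= !mxE.
by case: (e i) => /=; rewrite ?mulr1 ?mulr0 => /andP[? ?]; apply/andP; split; lra.
Qed.

Lemma bisect_child Q x : bisect Q (dyadic_child Q x).
Proof.
exists [ffun i => Q.1 0 i + Q.2 / 2 <= x 0 i] => //.
by congr (_ + _ *: _, _); apply/rowP => i; rewrite !mxE ffunE.
Qed.

Lemma mem_dyadic_child Q x : cube_set Q x -> cube_set (dyadic_child Q x) x.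
Proof.
move=> Qx i; have := Qx i; rewrite /= !mxE.
case: (leP (Q.1 0 i + Q.2 / 2)) => /= h /andP[h1 h2];
  by rewrite ?mulr1 ?mulr0; apply/andP; split; lra.
Qed.

Lemma bisect_unique Q J x : bisect Q J -> cube_set J x -> J = dyadic_child Q x.
Proof.
move=> [e _ <-] Jx; congr (_ + _ *: _, _); apply/rowP => i; rewrite !mxE.
have := Jx i; rewrite /= !mxE.
by case: (leP (Q.1 0 i + Q.2 / 2)) => /=; case: (e i) => //=;
  rewrite ?mulr1 ?mulr0 => ? /andP[? ?]; lra.
Qed.

Lemma dyadic_chain_side Q x k : (dyadic_chain Q x k).2 = Q.2 / 2 ^+ k.
Proof.
elim: k => [|k IH] /=; first by rewrite expr0 divr1.
by rewrite IH exprSr invfM mulrA.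
Qed.

Lemma dyadic_chain_side_gt0 Q x k : 0 < Q.2 -> 0 < (dyadic_chain Q x k).2.
Proof. by move=> Q0; rewrite dyadic_chain_side divr_gt0// exprn_gt0. Qed.

Lemma mem_dyadic_chain Q x k : cube_set Q x -> cube_set (dyadic_chain Q x k) x.
Proof. by move=> Qx; elim: k => //= k; exact: mem_dyadic_child. Qed.

Lemma dyadic_gen_chain Q x k : dyadic_gen k Q (dyadic_chain Q x k).
Proof.
elim: k => //= k IH; exists (dyadic_chain Q x k) => //; exact: bisect_child.
Qed.

Lemma dyadic_chainP Q x k : dyadic Q (dyadic_chain Q x k).
Proof. by exists k => //; exact: dyadic_gen_chain. Qed.

Lemma dyadic_gen_side Q J k : dyadic_gen k Q J -> J.2 = Q.2 / 2 ^+ k.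
Proof.
elim: k J => [|k IH] J /=; first by move=> ->; rewrite expr0 divr1.
by move=> [I /IH Ik /bisect_side ->]; rewrite Ik exprSr invfM mulrA.
Qed.

Lemma dyadic_gen_sub Q J k : 0 < Q.2 -> dyadic_gen k Q J ->
  cube_set J `<=` cube_set Q.
Proof.
move=> Q0; elim: k J => [|k IH] J /=; first by move=> ->.
move=> [I QI IJ]; apply: subset_trans (IH _ QI).
apply: bisect_sub => //; rewrite (dyadic_gen_side QI).
by rewrite divr_gt0// exprn_gt0.
Qed.

Lemma dyadic_gen_unique Q J k x : 0 < Q.2 -> dyadic_gen k Q J -> cube_set J x ->
  J = dyadic_chain Q x k.
Proof.
move=> Q0; elim: k J => [|k IH] J /=; first by move=> ->.
move=> [I QI IJ] Jx; rewrite (bisect_unique IJ Jx) -(IH _ QI)//.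
apply: bisect_sub IJ _ Jx; rewrite (dyadic_gen_side QI).
by rewrite divr_gt0// exprn_gt0.
Qed.

Lemma dyadic_side_gt0 Q J : 0 < Q.2 -> dyadic Q J -> 0 < J.2.
Proof.
by move=> Q0 [k _ /dyadic_gen_side ->]; rewrite divr_gt0// exprn_gt0.
Qed.

Lemma dyadic_sub Q J : 0 < Q.2 -> dyadic Q J -> cube_set J `<=` cube_set Q.
Proof. by move=> Q0 [k _]; exact: dyadic_gen_sub. Qed.

Lemma corner_in_cube Q : 0 < Q.2 -> cube_set Q Q.1.
Proof. by move=> Q0 i; rewrite lexx ltrDl. Qed.

Lemma dyadic_refl Q : dyadic Q Q.
Proof. by exists 0%N. Qed.

Lemma dyadic_chain_inj Q x : 0 < Q.2 -> injective (dyadic_chain Q x).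
Proof.
move=> Q0 j k /(congr1 snd); rewrite !dyadic_chain_side.
move/(mulfI (lt0r_neq0 Q0))/invr_inj/eqP.
by rewrite -!natrX eqr_nat eqn_exp2l// => /eqP.
Qed.

Lemma dyadic_through Q x : 0 < Q.2 -> cube_set Q x ->
  [set J | dyadic Q J /\ cube_set J x] = range (dyadic_chain Q x).
Proof.
move=> Q0 Qx; apply/seteqP; split=> [J [[k _ QJ] Jx]|_ [k _ <-]].
  by exists k => //; rewrite -(dyadic_gen_unique Q0 QJ Jx).
by split; [exact: dyadic_chainP|exact: mem_dyadic_chain].
Qed.

Lemma countable_dyadic Q : countable (dyadic Q).
Proof.
apply: bigcup_countable => // k _; apply: finite_set_countable.
elim: k => [|k IH] /=; first exact: finite_set1.
apply: bigcup_finite => // I _; apply: finite_image; exact: finite_finset.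
Qed.

Lemma dyadic_chain_nested Q x j k : 0 < Q.2 -> (j <= k)%N ->
  cube_set (dyadic_chain Q x k) `<=` cube_set (dyadic_chain Q x j).
Proof.
move=> Q0 /subnK <-; elim: (k - j)%N => [|m IH]; first by [].
rewrite addSn; apply: subset_trans IH; apply: bisect_sub.
  exact: dyadic_chain_side_gt0.
exact: bisect_child.
Qed.

Lemma dyadic_chain_shared Q x y k : 0 < Q.2 ->
  cube_set (dyadic_chain Q x k) y -> forall j, (j <= k)%N ->
  dyadic_chain Q x j = dyadic_chain Q y j.
Proof.
move=> Q0 ky j jk; apply: dyadic_gen_unique => //; first exact: dyadic_gen_chain.
exact: dyadic_chain_nested ky.
Qed.

(** A shorter [Q] would miss the corner of [J] translated by [Q.2] in every coordinate, which lies
    in [J]. In dimension 0 all cubes coincide as sets, whence [0 < n]. *)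
Lemma cube_set_le_side Q J : (0 < n)%N -> 0 < J.2 ->
  cube_set J `<=` cube_set Q -> J.2 <= Q.2.
Proof.
move=> n0 J0 JQ; rewrite leNgt; apply/negP => QJ; pose i := Ordinal n0.
have /andP[a1 a2] := JQ _ (corner_in_cube J0) i.
have Q0 : 0 < Q.2 by rewrite -(ltrD2l (Q.1 0 i)) addr0 (le_lt_trans a1).
have /(JQ _)/(_ i) : cube_set J (J.1 + const_mx Q.2).
  by move=> j; rewrite !mxE lerDl (ltW Q0) ltrD2l.
by rewrite !mxE => /andP[_]; move: a1; lra.
Qed.

Lemma dyadic_sub_self Q J : (0 < n)%N -> 0 < Q.2 -> dyadic Q J ->
  cube_set Q `<=` cube_set J -> J = Q.
Proof.
move=> n0 Q0 [[|k] _ QJ] //= /(cube_set_le_side n0 Q0).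
rewrite (dyadic_gen_side QJ) leNgt ltr_pdivrMr ?exprn_gt0// ltr_pMr//.
by rewrite -natrX ltr1n -[X in (X < _)%N](expn0 2) ltn_exp2l.
Qed.

(* The weights grow geometrically along the chain of cubes through x, so that the
   sum is comparable to its last term. *)
Lemma le_dyadic_sum_through Q x (w : cube R n -> R) (th M : R) :
  0 < Q.2 -> cube_set Q x -> 0 <= M -> 0 <= th < 1 ->
  (forall J, dyadic Q J -> 0 <= w J) ->
  (forall I J, dyadic Q I -> bisect I J -> w I <= th * w J) ->
  (\esum_(J in [set J | dyadic Q J /\ cube_set J x /\ (w J <= M)%R]) (w J)%:E <=
     (M / (1 - th))%:E)%E.
Proof.
move=> Q0 Qx M0 /andP[th0 th1] w0 wth.
have A0 : 0 < 1 - th by rewrite subr_gt0.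
pose b k := w (dyadic_chain Q x k).
have b0 k : 0 <= b k by apply: w0; exact: dyadic_chainP.
have bS k : b k <= th * b k.+1.
  by apply: wth; [exact: dyadic_chainP|exact: bisect_child].
have bmono j k : (j <= k)%N -> b j <= b k.
  move=> /subnK <-; elim: (k - j)%N => //= m IH.
  apply: (le_trans IH); rewrite addSn; apply: le_trans (bS _) _.
  by rewrite ler_piMl// ltW.
(* Since [b k] is at most [th * b k.+1], the earlier terms are absorbed by the last one up to the
   factor [(1 - th)^-1]. *)
have sb k : \sum_(i < k.+1) b i <= b k / (1 - th).
  elim: k => [|k IH].
    rewrite big_ord1 ler_pdivlMr//.
    by rewrite ler_piMr// gerBl.
  rewrite big_ord_recr/=; apply: le_trans (lerD IH (lexx _)) _.
  rewrite ler_pdivlMr// mulrDl divfK ?gt_eqF//.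
  by have := bS k; lra.
have -> : [set J | dyadic Q J /\ cube_set J x /\ w J <= M] =
    dyadic_chain Q x @` [set k | b k <= M].
  apply/seteqP; split=> [J [QJ [Jx wM]]|_ [k kM <-]]; last first.
    by split; [exact: dyadic_chainP|split=> //; exact: mem_dyadic_chain].
  have : range (dyadic_chain Q x) J by rewrite -dyadic_through.
  by move=> [k _ kJ]; exists k => //; rewrite /= /b kJ.
rewrite esum_image; last by move=> i j _ _; exact: dyadic_chain_inj.
have e0 k : (0 <= (b k)%:E)%E by rewrite lee_fin.
rewrite -(@nneseries_esum _ (fun k => (b k)%:E) (fun k => b k <= M)) => [|k _]; last exact: e0.
apply: lime_le; first by apply: is_cvg_nneseries_cond => k _ _; exact: e0.
apply: nearW => N; rewrite sumEFin lee_fin big_mkord.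
elim: N => [|N IH]; first by rewrite big_ord0 divr_ge0// ltW.
rewrite big_mkcond big_ord_recr/= -big_mkcond/=; case: ifPn => [bN|_]; last by rewrite addr0.
rewrite (eq_bigl predT) => [|i]; last first.
  by apply: le_trans bN; apply: bmono; apply: ltnW; exact: ltn_ord.
have := sb N; rewrite big_ord_recr/= => /le_trans; apply.
by rewrite ler_pM2r ?invr_gt0.
Qed.
End dyadic_chain.

(** * Quasisymmetric maps *)

Section norms.
Context (R : realType) (n : nat).
Implicit Types (x y z v : 'rV[R]_n).

Lemma ler_coord_norm v i : `|v 0 i| <= `|v|.
Proof.
by rewrite [leRHS]/Num.norm/= mx_normrE (le_bigmax _ (fun ij => `|v ij.1 ij.2|) (0, i)).
Qed.

Lemma rV_norm_leP v (e : R) : 0 <= e -> (forall i, `|v 0 i| <= e) -> `|v| <= e.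
Proof.
move=> e0 h; rewrite [leLHS]/Num.norm/= mx_normrE; apply/bigmax_leP; split=> //= -[i j] _.
by rewrite (ord1 i); exact: h.
Qed.

Lemma rV_norm_ltP v (e : R) : 0 < e -> (forall i, `|v 0 i| < e) -> `|v| < e.
Proof.
move=> e0 h; rewrite [ltLHS]/Num.norm/= mx_normrE; apply/bigmax_ltP; split=> //= -[i j] _.
by rewrite (ord1 i); exact: h.
Qed.

Lemma enorm_ge0 v : 0 <= enorm v. Proof. exact: sqrtr_ge0. Qed.

Lemma norm_le_enorm v : `|v| <= enorm v.
Proof.
apply: rV_norm_leP => [|i]; first exact: enorm_ge0.
rewrite -sqrtr_sqr ler_wsqrtr// (bigD1 i)//= lerDl.
by apply: sumr_ge0 => j _; rewrite sqr_ge0.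
Qed.

Lemma enorm_le_norm v : enorm v <= n%:R * `|v|.
Proof.
rewrite -[leRHS]ger0_norm ?mulr_ge0// -sqrtr_sqr ler_wsqrtr//.
apply: (@le_trans _ _ (\sum_(i < n) `|v| ^+ 2)).
  by apply: ler_sum => i _; rewrite -[leLHS]real_normK ?num_real// lerXn2r ?nnegrE// ler_coord_norm.
rewrite sumr_const card_ord -[leLHS]mulr_natl exprMn ler_wpM2r ?sqr_ge0//.
by rewrite -natrX ler_nat; case: (n) => // m; rewrite leq_pmulr.
Qed.

End norms.

(* The factor 4 allows comparing a dyadic cube with its parent: a point of the
   parent is at distance at most four half-sides from the centre of the child. *)
Definition weakly_quasisymmetric (R : realType) (n : nat)
    (psi : 'rV[R]_n -> 'rV[R]_n) (H : R) :=
  forall x y z, `|x - y| <= 4 * `|x - z| -> `|psi x - psi y| <= H * `|psi x - psi z|.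

(** Quasisymmetry of [phi] is applied at the points [psi x], [psi z], [psi y]. With
    [eta d = 1 / (4 n)], a ratio of [|psi x - psi z|] to [|psi x - psi y|] below [d] would force
    [|x - y| > 4 n |x - z|] in the Euclidean norm, which the sup-norm hypothesis excludes because
    the two norms differ at most by the factor [n]. *)
Lemma quasisymmetric_inv (R : realType) (n : nat) (eta : R -> R) : (0 < n)%N ->
  increasing_homeo eta ->
  exists2 H : R, 1 <= H & forall phi psi : 'rV[R]_n -> 'rV[R]_n,
    quasisymmetric eta phi psi -> weakly_quasisymmetric psi H.
Proof.
move=> n0 [[_ _ etasurj] _ etam eta0].
have n0' : 0 < n%:R :> R by rewrite ltr0n.
have e0 : 0 < (4 * n%:R)^-1 :> R by rewrite invr_gt0 mulr_gt0.
have [d + etad] := etasurj (4 * n%:R)^-1 ltac:(by rewrite /= in_itv/= andbT ltW).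
rewrite /= in_itv/= andbT le_eqVlt => /predU1P[d0|d0].
  by move: e0; rewrite -etad -d0 eta0 ltxx.
(* The summand [n / d] is the distortion bound, with [n] from the change of norms; the summand 1
   gives [1 <= H] and settles the case [y = z]. *)
exists (1 + n%:R / d) => [|phi psi [[phiK psiK _ _] _ qs] x y z xyz].
  by rewrite lerDl divr_ge0 ?ltW.
have [->|yx] := eqVneq y x; first by rewrite subrr normr0 mulr_ge0// addr_ge0// divr_ge0// ltW.
have [zx|zx] := eqVneq z x.
  by move: xyz; rewrite zx subrr normr0 mulr0 normr_le0 subr_eq0 eq_sym (negbTE yx).
have [->|yz] := eqVneq y z; first by rewrite ler_peMl// lerDl divr_ge0 ?ltW.
have psi_inj : injective psi := can_inj psiK.
have := qs (psi x) (psi z) (psi y); rewrite !(inj_eq psi_inj) !psiK => /(_ _ _ _)H.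
have {H} := H ltac:(by rewrite eq_sym) ltac:(by rewrite eq_sym) ltac:(by rewrite eq_sym).
set r := enorm (psi x - psi z) / _ => etar.
have pos u v : u != v -> 0 < enorm (u - v) :> R.
  by move=> uv; apply: lt_le_trans (norm_le_enorm _); rewrite normr_gt0 subr_eq0.
have xy0 : 0 < enorm (x - y) by apply: pos; rewrite eq_sym.
have pxy0 : 0 < enorm (psi x - psi y) by apply: pos; rewrite inj_eq// eq_sym.
have r0 : 0 <= r by rewrite divr_ge0// enorm_ge0.
have dr : d <= r.
  rewrite leNgt; apply/negP => rd.
  have := etam r d; rewrite !in_itv/= !andbT r0 (ltW d0) => /(_ erefl erefl rd).
  rewrite etad ltNge => /negP; apply; apply: le_trans etar.
  rewrite ler_pdivlMr// ler_pdivrMl ?mulr_gt0//.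
  apply: (le_trans (enorm_le_norm _)); rewrite (mulrC 4) -mulrA ler_pM2l//.
  by apply: (le_trans xyz); rewrite ler_pM2l// norm_le_enorm.
apply: (le_trans (norm_le_enorm _)).
move: dr; rewrite /r ler_pdivlMr// mulrC -ler_pdivlMr// => /le_trans; apply.
rewrite ler_pdivrMr// mulrDl mulrDl mul1r mulrAC divfK ?gt_eqF//.
by rewrite (le_trans (enorm_le_norm _))// lerDr mulr_ge0// ltW.
Qed.

(** * Energy on a cube and oscillation on dyadic cubes *)

(** Cauchy-Schwarz with the weights [th ^ i], whose sum is at most [(1 - th)^-1]. *)
Lemma sqr_sum_le_weighted (R : realFieldType) (th : R) (b : nat -> R) N :
  0 < th < 1 ->
  (\sum_(i < N) b i) ^+ 2 <= (1 - th)^-1 * \sum_(i < N) th ^- i * b i ^+ 2.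
Proof.
move=> /andP[th0 th1]; have A0 : 0 < 1 - th by rewrite subr_gt0.
elim: N b => [|N IH] b; first by rewrite !big_ord0 expr0n mulr0.
rewrite !big_ord_recl /= expr0 invr1 mul1r.
under eq_bigr do rewrite /bump/= add1n.
under [in leRHS]eq_bigr do rewrite /bump/= add1n exprS invfM -mulrA.
rewrite -mulr_sumr; have := IH (fun i => b i.+1).
set s := \sum_(i < N) _; set T := \sum_(i < N) _ => sT.
(* Two-term Cauchy-Schwarz with the weights [1 - th] and [th], which add up to 1; the difference of
   the two sides is a square over a positive number. *)
apply: (@le_trans _ _ (b 0%N ^+ 2 / (1 - th) + s ^+ 2 / th)).
  rewrite -subr_ge0.
  have -> : b 0%N ^+ 2 / (1 - th) + s ^+ 2 / th - (b 0%N + s) ^+ 2 =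
      (th * b 0%N - (1 - th) * s) ^+ 2 / (th * (1 - th)).
    by field; rewrite !gt_eqF.
  by rewrite divr_ge0 ?sqr_ge0 ?mulr_ge0 ?ltW.
rewrite mulrDr mulrC lerD2l mulrCA [leLHS]mulrC ler_pM2l ?invr_gt0//.
Qed.

(** * The one-third trick for shifted dyadic grids *)

Section third_trick.
Context (R : realType) (n : nat).
Implicit Types (Q J : cube R n) (x y : 'rV[R]_n) (t : {ffun 'I_n -> bool}).

(* One-third trick: in each coordinate the level-K grids of the two shifts are
   l / 2 ^ K apart, since 3 does not divide 2 ^ K; so one of them has no point
   between x_i and y_i. *)
Definition shifted_cube Q t : cube R n :=
  (\row_i (Q.1 0 i - Q.2 + (t i)%:R * Q.2), 3 * Q.2).

Lemma shifted_cube_sup Q t : cube_set Q `<=` cube_set (shifted_cube Q t).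
Proof.
move=> x Qx i; have := Qx i; rewrite /= !mxE.
by case: (t i) => /= /andP[? ?]; rewrite ?mul1r ?mul0r; apply/andP; split; lra.
Qed.

Lemma dyadic_chain_corner Q x k i : exists m : nat,
  (dyadic_chain Q x k).1 0 i = Q.1 0 i + m%:R * (Q.2 / 2 ^+ k).
Proof.
elim: k => [|k [m IH]]; first by exists 0%N; rewrite mul0r addr0.
rewrite /= !mxE IH dyadic_chain_side; set b := (X in _ / 2 * X%:R).
exists (m.*2 + b)%N; rewrite -muln2 natrD natrM exprSr; field.
by rewrite expf_neq0// pnatr_eq0.
Qed.

(** Counted from [c] in units of [l / 2 ^ K], the two grid points are the integers [3 m0] and
    [2 ^ K + 3 m]. Both lie in an interval shorter than one unit, so they coincide and 3 divides
    [2 ^ K]. *)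
Lemma third_shift_grids_apart (K m m0 : nat) (l a b c : R) : 0 < l ->
  b - a < l / 2 ^+ K ->
  a < c + m0%:R * (3 * l / 2 ^+ K) <= b ->
  a < c + l + m%:R * (3 * l / 2 ^+ K) <= b -> False.
Proof.
move=> l0 ab /andP[a1 b1] /andP[a2 b2].
have K0 : 0 < 2 ^+ K :> R by rewrite exprn_gt0.
have e0 : 0 < l / 2 ^+ K by rewrite divr_gt0.
have E k : k%:R * (3 * l / 2 ^+ K) = (3 * k)%:R * (l / 2 ^+ K).
  by rewrite natrM; field; rewrite gt_eqF.
have El : l = (2 ^ K)%:R * (l / 2 ^+ K) by rewrite natrX; field; rewrite gt_eqF.
rewrite E in a1 b1; rewrite E {1}El -addrA -mulrDl -natrD in a2 b2.
have h1 : (3 * m0 < (2 ^ K + 3 * m).+1)%N.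
  by rewrite -(ltr_nat R) -natr1 -(ltr_pM2r e0) mulrDl mul1r; lra.
have h2 : (2 ^ K + 3 * m < (3 * m0).+1)%N.
  by rewrite -(ltr_nat R) -natr1 -(ltr_pM2r e0) mulrDl mul1r; lra.
have : (3 %| 2 ^ K)%N.
  have : (2 ^ K + 3 * m = 3 * m0)%N by lia.
  by move=> h; rewrite -(dvdn_addl _ (dvdn_mulr m (dvdnn 3))) h dvdn_mulr.
by rewrite Euclid_dvdX.
Qed.

Lemma third_trick Q x y K : 0 < Q.2 -> cube_set Q x -> cube_set Q y ->
  (forall i, `|x 0 i - y 0 i| < Q.2 / 2 ^+ K) ->
  exists t, cube_set (dyadic_chain (shifted_cube Q t) x K) y.
Proof.
move=> Q0 Qx Qy xyK; pose S := 3 * Q.2 / 2 ^+ K.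
(* The grid of level [K] based at [c] separates the two coordinates, with the half-open convention
   of the cubes. The shift is used exactly in those coordinates where the grid of the unshifted
   choice separates. *)
pose hit i (c : R) := exists m : nat,
  Num.min (x 0 i) (y 0 i) < c + m%:R * S <= Num.max (x 0 i) (y 0 i).
exists [ffun i => `[< hit i (Q.1 0 i - Q.2) >]]; set t := finfun _ => i.
have [m mE] := dyadic_chain_corner (shifted_cube Q t) x K i.
have := mem_dyadic_chain K (@shifted_cube_sup Q t _ Qx) i.
rewrite dyadic_chain_side mE /= -/S => xJ.
apply: contrapT => /negP yJ.
(* If [y] leaves the cube of [x] in coordinate [i], the lower end (index [m]) or the upper end
   (index [m.+1]) of its side separates the two points. *)
have [m' hm'] : hit i (Q.1 0 i - Q.2 + (t i)%:R * Q.2).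
  move: yJ xJ; rewrite negb_and -ltNge -leNgt mxE => /orP[yc|yc] /andP[xc xc'].
    by exists m; rewrite gt_min le_max yc xc orbT.
  by exists m.+1; rewrite gt_min le_max -natr1 mulrDl mul1r addrA yc xc' orbT.
move: hm'; rewrite {1 2}/t ffunE; case: asboolP => [[m0 hm0]|nohit].
  rewrite mul1r => hm'.
  apply: (third_shift_grids_apart Q0 _ hm0 hm').
  have := xyK i; have [h|h] := leP (x 0 i) (y 0 i).
    by rewrite distrC ger0_norm ?subr_ge0.
  by rewrite gtr0_norm ?subr_gt0.
by rewrite mul0r addr0 => h; apply: nohit; exists m'.
Qed.

End third_trick.

(** * Telescoping along dyadic chains *)

Section telescoping.
Context (R : realType) (n : nat) (alpha : R).
Hypothesis n_gt0 : (0 < n)%N.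
Hypothesis alpha_gt0 : 0 < alpha.
Context (u : 'rV[R]_n -> R) (zz : cube R n -> 'rV[R]_n) (s : cube R n -> R).
Hypothesis u_cts : continuous u.
Hypothesis s_ge0 : forall J, 0 < J.2 -> 0 <= s J.
Hypothesis zz_in : forall J, 0 < J.2 -> cube_set J (zz J).
Hypothesis zz_child : forall I J, 0 < I.2 -> bisect I J ->
  (u (zz I) - u (zz J)) ^+ 2 <= s I + s J.
Implicit Types (Q J : cube R n) (x y : 'rV[R]_n).

Local Notation th := ((2 : R) `^ (- alpha)).

Lemma telescoping_ratio_bounds : 0 < th < 1.
Proof.
rewrite powR_gt0//= powRN invf_lt1 ?powR_gt0//.
have := @gt0_ltr_powR _ _ alpha_gt0 1 2.
by rewrite powR1; apply; rewrite ?nnegrE// ltr1n.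
Qed.

Lemma cube_set_dist Q x y : cube_set Q x -> cube_set Q y -> `|x - y| <= Q.2.
Proof.
move=> Qx Qy; apply: rV_norm_leP => [|i].
  by have /andP[] := Qx (Ordinal n_gt0); lra.
by have /andP[? ?] := Qx i; have /andP[? ?] := Qy i; rewrite !mxE ler_norml; apply/andP; split; lra.
Qed.

Lemma base_point_cvg Q x K : 0 < Q.2 -> cube_set Q x ->
  zz (dyadic_chain Q x (K + N)) @[N --> \oo] --> x.
Proof.
move=> Q0 Qx; apply/cvgrPdist_le => e e0.
have : Q.2 * 2^-1 ^+ N @[N --> \oo] --> Q.2 * 0.
  apply: cvgMr; apply: cvg_expr.
  by rewrite gtr0_norm ?invr_gt0// invf_lt1// ltr1n.
rewrite mulr0 => /cvgrPdist_le/(_ _ e0); apply: filterS => N.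
have q0 : 0 <= Q.2 * 2^-1 ^+ N by rewrite pmulr_rge0// exprn_ge0.
rewrite sub0r normrN ger0_norm// => h.
apply: le_trans h; apply: (@le_trans _ _ (dyadic_chain Q x (K + N)).2).
  apply: cube_set_dist; first exact: mem_dyadic_chain.
  by apply: zz_in; exact: dyadic_chain_side_gt0.
rewrite dyadic_chain_side exprVn ler_pM2l// lef_pV2 ?posrE ?exprn_gt0//.
by rewrite ler_eXn2l ?ltr1n// leq_addl.
Qed.

(* Any exponent in ]0, 2 alpha[ would do for the weights: positivity makes the
   Cauchy-Schwarz weights summable here, and less than 2 alpha makes the sum over
   the ancestors of J converge in third_sum. *)
Lemma telescoping_bound Q x K : 0 < Q.2 -> cube_set Q x ->
  (((u x - u (zz (dyadic_chain Q x K))) ^+ 2)%:E <=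
   (2 / (1 - th))%:E *
   \esum_(J in [set J | dyadic Q J /\ cube_set J x /\
                        cube_set J `<=` cube_set (dyadic_chain Q x K)])
     (((dyadic_chain Q x K).2 / J.2) `^ alpha * s J)%:E)%E.
Proof.
move=> Q0 Qx; set J0 := dyadic_chain Q x K; set S := [set J | _].
have /andP[th0 th1] := telescoping_ratio_bounds.
have A0 : 0 < 1 - th by rewrite subr_gt0.
pose c k := dyadic_chain Q x (K + k).
have c0 k : 0 < (c k).2 by exact: dyadic_chain_side_gt0.
pose a k := th ^- k * s (c k).
have a0 k : 0 <= a k by rewrite pmulr_rge0 ?s_ge0// invr_gt0 exprn_gt0.
set E := esum _ _.
(* The cubes of the chain from [J0] downwards are distinct members of the index set, and
   [(J0.2 / J.2) ^ alpha] equals [th ^ (- k)] at depth [k]. *)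
have aE N : ((\sum_(k < N) a k)%:E <= E)%E.
  have -> : (\sum_(k < N) a k)%:E = (\sum_(0 <= k < N) (a k)%:E)%E.
    by rewrite big_mkord sumEFin.
  apply: (@le_trans _ _ (\sum_(0 <= k <oo) (a k)%:E)%E).
    by apply: nneseries_lim_ge => k _ _; rewrite lee_fin.
  rewrite nneseries_esumT; last by move=> k; rewrite lee_fin.
  pose g J : \bar R := ((J0.2 / J.2) `^ alpha * s J)%:E.
  rewrite (eq_esum (b := g \o c)); last first.
    move=> k _; rewrite /g /= /a; congr (_ * _)%:E.
    rewrite /J0 /c !dyadic_chain_side exprD.
    rewrite (_ : _ / _ = 2 ^+ k); last by field; rewrite !expf_neq0// gt_eqF.
    by rewrite powRN exprVn invrK -powR_mulrn ?powR_ge0// powRAC powR_mulrn.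
  rewrite -(@esum_image _ _ _ setT c g).
    apply: esum_subset => _ [k _ <-]; split; first exact: dyadic_chainP.
    split; first exact: mem_dyadic_chain.
    by apply: dyadic_chain_nested => //; rewrite leq_addr.
  by move=> i j _ _ /(dyadic_chain_inj Q0) /addnI.
have [Eoo|] := eqVneq E +oo%E; first by rewrite Eoo gt0_muley ?leey// lte_fin divr_gt0.
have E0 : (0 <= E)%E by have := aE 0%N; rewrite big_ord0.
rewrite -ltey -ge0_fin_numE// => Efin.
rewrite -(fineK Efin) -EFinM lee_fin.
have bound N : (u (zz (c N)) - u (zz (c 0%N))) ^+ 2 <= 2 / (1 - th) * fine E.
  pose b k := u (zz (c k.+1)) - u (zz (c k)).
  have -> : u (zz (c N)) - u (zz (c 0%N)) = \sum_(k < N) b k.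
    by rewrite -(big_mkord xpredT b) /b telescope_sumr.
  apply: (le_trans (@sqr_sum_le_weighted _ th b N telescoping_ratio_bounds)).
  rewrite (mulrC 2) -mulrA ler_pM2l ?invr_gt0//.
  (* The term of the child is moved to index [k.+1], because [th ^ (- k)] increases with [k]. Each
     [a k] is then used at most twice, whence the factor 2. *)
  have hb k : th ^- k * b k ^+ 2 <= a k + a k.+1.
    apply: (@le_trans _ _ (th ^- k * (s (c k) + s (c k.+1)))).
      rewrite ler_pM2l ?invr_gt0 ?exprn_gt0// /b -sqrrN opprB; apply: zz_child => //.
      by rewrite /c addnS; exact: bisect_child.
    rewrite mulrDr lerD2l ler_wpM2r ?s_ge0//.
    by rewrite lef_pV2 ?posrE ?exprn_gt0// exprS ler_piMl ?exprn_ge0 ?ltW.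
  apply: (@le_trans _ _ (\sum_(k < N) a k + \sum_(k < N) a k.+1)).
    by rewrite -big_split; apply: ler_sum => k _; exact: hb.
  have := aE N; rewrite -(fineK Efin) lee_fin => h1.
  have := aE N.+1; rewrite -(fineK Efin) lee_fin big_ord_recl => h2.
  have -> : \sum_(k < N) a k.+1 = \sum_(i < N) a (lift ord0 i) by apply: eq_bigr.
  by have := a0 0%N; rewrite /= in h2 *; lra.
(* The bound is uniform in [N], and continuity of [u] at [x] identifies the limit of the left-hand
   side. *)
have cv : (u (zz (c N)) - u (zz (c 0%N))) ^+ 2 @[N --> \oo] -->
    (u x - u (zz J0)) ^+ 2.
  rewrite [X in _ --> X]expr2; under eq_fun do rewrite expr2.
  have cvu : u (zz (c N)) - u (zz (c 0%N)) @[N --> \oo] --> u x - u (zz J0).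
    apply: cvgB; last by rewrite /c addn0; exact: cvg_cst.
    by apply: continuous_cvg; [exact: u_cts|exact: base_point_cvg].
  exact: cvgM.
apply: (cvgr_to_le cv).
exact: nearW.
Qed.

End telescoping.

(** * The kernel and the energy of a function on a set *)

Section kernel.
Context (R : realType) (n : nat) (f : 'rV[R]_n -> R) (p : R).
Hypothesis f_cts : continuous f.
Local Notation mu := (lebesgue_rV R n).
Local Notation mu2 := (lebesgue_rV R n \x lebesgue_rV R n)%E.

Definition sqdiff (z : 'rV[R]_n * 'rV[R]_n) : R := `|f z.1 - f z.2| ^+ 2.

Definition qkernel (z : 'rV[R]_n * 'rV[R]_n) : R :=
  sqdiff z / enorm (z.1 - z.2) `^ p.

(** A single integral for the product measure, which exchanges with sums over dyadic cubes in one
    step; [qenergyE] identifies it with the iterated integral in [Qnorm]. *)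
Definition qenergy (A : set 'rV[R]_n) : \bar R :=
  (\int[mu2]_(z in A `*` A) (qkernel z)%:E)%E.

Lemma sqdiff_ge0 z : 0 <= sqdiff z. Proof. exact: sqr_ge0. Qed.

Lemma qkernel_ge0 z : 0 <= qkernel z.
Proof. by rewrite divr_ge0 ?sqdiff_ge0 ?powR_ge0. Qed.

Lemma measurable_sqdiff :
  measurable_fun setT (sqdiff : _ -> measurableTypeR R).
Proof.
apply: measurable_funX; apply: measurableT_comp => //.
apply: measurable_funB; apply: measurableT_comp => //; exact: continuous_measurable_rV.
Qed.

Lemma measurable_enormB :
  measurable_fun setT (fun z : 'rV[R]_n * 'rV[R]_n => enorm (z.1 - z.2) : measurableTypeR R).
Proof.
apply: (@measurableT_comp _ _ _ _ _ _ (@Num.sqrt R)).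
  by apply: continuous_measurable_fun; exact: sqrt_continuous.
apply: measurable_sum => i; apply: measurable_funX.
have -> : (fun z : 'rV[R]_n * 'rV[R]_n => (z.1 - z.2) 0 i) =
   (rV_coord i \o fst) \- (rV_coord i \o snd) by apply/funext => z /=; rewrite !mxE.
by apply: measurable_funB; apply: measurableT_comp => //; exact: measurable_rV_coord.
Qed.

Lemma measurable_qkernel :
  measurable_fun setT (qkernel : _ -> measurableTypeR R).
Proof.
have -> : qkernel = sqdiff \* (fun z => enorm (z.1 - z.2) `^ (- p)).
  by apply/funext => z /=; rewrite powRN.
apply: measurable_funM; first exact: measurable_sqdiff.
by apply: (measurableT_comp (measurable_powR _)); exact: measurable_enormB.
Qed.

Lemma qenergyE (A : set 'rV[R]_n) : measurable A ->
  qenergy A = (\int[mu]_(x in A) \int[mu]_(y in A)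
    (`|f x - f y| ^+ 2 / enorm (x - y) `^ p)%:E)%E.
Proof.
move=> mA; rewrite -[RHS]/(\int[mu]_(x in A) \int[mu]_(y in A) (EFin \o qkernel) (x, y))%E.
rewrite integral_setX//; first by apply: measurableT_comp => //; exact: measurable_qkernel.
by move=> z; rewrite lee_fin qkernel_ge0.
Qed.

Lemma qenergy_subset (A B : set 'rV[R]_n) : measurable A -> measurable B ->
  A `<=` B -> (qenergy A <= qenergy B)%E.
Proof.
move=> mA mB AB; apply: ge0_subset_integral.
- exact: measurableX.
- exact: measurableX.
- apply: measurable_funTS; apply: measurableT_comp => //; exact: measurable_qkernel.
- by move=> z _; rewrite lee_fin qkernel_ge0.
- by move=> [x y] /= [? ?]; split; exact: AB.
Qed.

End kernel.

Lemma exists_dyadic_scale (R : realType) (l r : R) : 0 < r < l ->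
  exists K : nat, l / 2 ^+ K.+1 <= r < l / 2 ^+ K.
Proof.
move=> /andP[r0 rl].
have ex : exists K, l / 2 ^+ K.+1 <= r.
  exists (Num.bound (l / r)); rewrite ler_pdivrMr ?exprn_gt0// mulrC -ler_pdivrMr//.
  apply: (le_trans (ltW (archi_boundP _))); first exact: divr_ge0 (ltW (lt_trans r0 rl)) (ltW r0).
  rewrite -natrX ler_nat; apply: ltnW.
  by apply: (leq_trans (@ltn_expl 2 _ isT)); rewrite leq_exp2l.
case: (ex_minnP ex) => -[|K] hK Kmin.
  by exists 0%N; rewrite hK expr0 divr1.
exists K.+1; rewrite hK ltNge; apply/negP => h.
by have := Kmin K h; rewrite ltnn.
Qed.

(** * Energy on a cube bounded by sums over shifted dyadic cubes *)

Section chain_energy.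
Context (R : realType) (n : nat) (alpha : R).
Hypothesis n_gt0 : (0 < n)%N.
Hypothesis alpha_gt0 : 0 < alpha.
Context (u : 'rV[R]_n -> R) (zz : cube R n -> 'rV[R]_n) (s : cube R n -> R).
Hypothesis u_cts : continuous u.
Hypothesis s_ge0 : forall J, 0 < J.2 -> 0 <= s J.
Hypothesis zz_in : forall J, 0 < J.2 -> cube_set J (zz J).
Hypothesis zz_child : forall I J, 0 < I.2 -> bisect I J ->
  (u (zz I) - u (zz J)) ^+ 2 <= s I + s J.
Implicit Types (Q J : cube R n) (x y : 'rV[R]_n).
Local Notation mu := (lebesgue_rV R n).
Local Notation mu2 := (lebesgue_rV R n \x lebesgue_rV R n)%E.

Local Notation th := ((2 : R) `^ (- alpha)).
Local Notation p := (n%:R + 2 * alpha).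

Let th01 := telescoping_ratio_bounds alpha_gt0.
Let A2 : R := 2 / (1 - th).
Let A20 : 0 < A2. Proof. by have /andP[_ ?] := th01; rewrite divr_gt0// subr_gt0. Qed.

(** [6 ^ p] comes from [|x - y| >= J.2 / 6], the factor 2 from [(a + b)^2 <= 2 a^2 + 2 b^2], and
    [A2] from [telescoping_bound]. *)
Definition third_const : R := 6 `^ p * 2 * A2.

Lemma third_const_gt0 : 0 < third_const.
Proof. by apply: mulr_gt0 A20; rewrite mulr_gt0 ?powR_gt0. Qed.

Definition third_weight J J' : R :=
  third_const * J.2 `^ (- p) * ((J.2 / J'.2) `^ alpha * s J').

(** Contribution of a pair of cubes to a majorant of the kernel: [J] contains both points and is of
    the size of their distance, [J'] is a cube of the telescoping around one of them. With
    indicators the index set no longer depends on the points, so that the sum can be integrated. *)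
Definition third_term J J' (z : 'rV[R]_n * 'rV[R]_n) : R :=
  third_weight J J' * (\1_(cube_set J') z.1 * \1_(cube_set J) z.2 +
                       \1_(cube_set J') z.2 * \1_(cube_set J) z.1).

Lemma third_weight_ge0 J J' : 0 < J.2 -> 0 < J'.2 -> 0 <= third_weight J J'.
Proof.
move=> J0 J'0; rewrite /third_weight; apply: mulr_ge0; last first.
  by rewrite mulr_ge0 ?powR_ge0 ?s_ge0.
by rewrite mulr_ge0 ?powR_ge0 ?ltW ?third_const_gt0.
Qed.

Lemma third_term_ge0 J J' z : 0 < J.2 -> 0 < J'.2 -> 0 <= third_term J J' z.
Proof.
move=> J0 J'0; rewrite /third_term mulr_ge0 ?third_weight_ge0// addr_ge0// mulr_ge0.
Qed.

Lemma qkernel_le_sub Q J x : 0 < Q.2 -> dyadic Q J -> cube_set J x ->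
  ((third_const * J.2 `^ (- p))%:E *
   (\esum_(J' in [set J' | dyadic Q J' /\ cube_set J' x /\ cube_set J' `<=` cube_set J])
      ((J.2 / J'.2) `^ alpha * s J')%:E) <=
   \esum_(J' in [set J' | dyadic Q J' /\ cube_set J' `<=` cube_set J])
      (third_weight J J' * \1_(cube_set J') x)%:E)%E.
Proof.
move=> Q0 QJ Jx; have J0 := dyadic_side_gt0 Q0 QJ.
rewrite -esumZl; last 2 first.
- by rewrite mulr_ge0 ?powR_ge0 ?ltW ?third_const_gt0.
- by move=> J' [/(dyadic_side_gt0 Q0) J'0 _]; rewrite lee_fin mulr_ge0 ?powR_ge0 ?s_ge0.
apply: le_esum_support => J'.
  move=> [/(dyadic_side_gt0 Q0) J'0 _].
  by rewrite lee_fin mulr_ge0// third_weight_ge0.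
move=> [QJ' [J'x J'J]]; right; split=> //.
by rewrite indicE mem_set// mulr1 -EFinM lee_fin.
Qed.

(** At the scale of [|x - y|] the one-third trick yields one cube [J] containing both points; [u x]
    and [u y] are then both compared with the value at the base point of [J]. *)
Lemma qkernel_third Q z : 0 < Q.2 -> cube_set Q z.1 -> cube_set Q z.2 ->
  ((qkernel u p z)%:E <= \sum_(t : {ffun 'I_n -> bool})
    \esum_(J in dyadic (shifted_cube Q t))
      \esum_(J' in [set J' | dyadic (shifted_cube Q t) J' /\
                             cube_set J' `<=` cube_set J])
        (third_term J J' z)%:E)%E.
Proof.
case: z => x y /= Q0 Qx Qy.
have S0 t : 0 < (shifted_cube Q t).2 by rewrite mulr_gt0.
have pos t J : dyadic (shifted_cube Q t) J -> (0 <= \esum_(J' in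
    [set J' | dyadic (shifted_cube Q t) J' /\ cube_set J' `<=` cube_set J])
        (third_term J J' (x, y))%:E)%E.
  move=> /(dyadic_side_gt0 (S0 t)) J0; apply: esum_ge0 => J' [/(dyadic_side_gt0 (S0 t)) J'0 _].
  by rewrite lee_fin third_term_ge0.
have pos' t : (0 <= \esum_(J in dyadic (shifted_cube Q t)) \esum_(J' in
    [set J' | dyadic (shifted_cube Q t) J' /\ cube_set J' `<=` cube_set J])
        (third_term J J' (x, y))%:E)%E.
  by apply: esum_ge0 => J; exact: pos.
have [exy|xy] := eqVneq x y.
  rewrite (_ : qkernel u p (x, y) = 0); first by apply: sume_ge0 => t _; exact: pos'.
  by rewrite /qkernel /sqdiff /= exy subrr normr0 expr0n mul0r.
have r0 : 0 < `|x - y| by rewrite normr_gt0 subr_eq0.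
have rl : `|x - y| < Q.2.
  apply: rV_norm_ltP => // i; have /andP[? ?] := Qx i; have /andP[? ?] := Qy i.
  by rewrite !mxE ltr_norml; apply/andP; split; lra.
have [K /andP[rK rK']] : exists K : nat, Q.2 / 2 ^+ K.+1 <= `|x - y| < Q.2 / 2 ^+ K.
  by apply: exists_dyadic_scale; rewrite r0 rl.
have [t yJ] : exists t, cube_set (dyadic_chain (shifted_cube Q t) x K) y.
  apply: third_trick => // i; apply: le_lt_trans rK'.
  by have := ler_coord_norm (x - y) i; rewrite !mxE.
rewrite (bigD1 t)//=; apply: (@le_trans _ _ _); last first.
  by apply: leeDl; apply: sume_ge0 => t' _; exact: pos'.
have Qtx := @shifted_cube_sup _ _ Q t _ Qx; have Qty := @shifted_cube_sup _ _ Q t _ Qy.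
set J := dyadic_chain _ x K in yJ *; have QJ : dyadic (shifted_cube Q t) J by exact: dyadic_chainP.
have xJ : cube_set J x by exact: mem_dyadic_chain.
have J0 := dyadic_side_gt0 (S0 t) QJ.
apply: (@le_trans _ _ _); last first.
  apply: (@esum_subset _ _ [set J]) => J'' ->; exact: QJ.
rewrite esum_set1; last exact: pos.
rewrite (eq_esum (b := fun J' => (third_weight J J' * \1_(cube_set J') x)%:E +
    (third_weight J J' * \1_(cube_set J') y)%:E)%E); last first.
  move=> J' [QJ' J'J]; rewrite -EFinD /third_term /= !indicE (mem_set xJ) (mem_set yJ).
  by rewrite !mulr1 mulrDr.
have tw0 v J' : [set J' | dyadic (shifted_cube Q t) J' /\ cube_set J' `<=` cube_set J] J' ->
    (0 <= (third_weight J J' * \1_(cube_set J') v)%:E)%E.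
  by move=> [/(dyadic_side_gt0 (S0 t)) J'0 _]; rewrite lee_fin mulr_ge0// third_weight_ge0.
rewrite esumD//; [|exact: tw0|exact: tw0].
apply: (le_trans _ (leeD (qkernel_le_sub (S0 t) QJ xJ) (qkernel_le_sub (S0 t) QJ yJ))).
(* [J] also belongs to the chain of [y], so both telescopings start from the same base point. *)
have Jy : J = dyadic_chain (shifted_cube Q t) y K.
  by apply: dyadic_chain_shared yJ _ _.
have := telescoping_bound n_gt0 alpha_gt0 u_cts s_ge0 zz_in zz_child K (S0 t) Qtx.
have := telescoping_bound n_gt0 alpha_gt0 u_cts s_ge0 zz_in zz_child K (S0 t) Qty.
rewrite -Jy -/J -/A2; set Ey := esum _ _; set Ex := esum _ _; set a := u (zz J) => hy hx.
pose D : R := 6 `^ p * 2 * J.2 `^ (- p).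
have D0 : 0 <= D by rewrite !mulr_ge0 ?powR_ge0.
have DE : third_const * J.2 `^ (- p) = D * A2 by rewrite /third_const /D; ring.
rewrite DE (EFinM D A2) -!muleA.
have D0' : (0 <= D%:E)%E by rewrite lee_fin.
apply: (le_trans _ (leeD (lee_wpmul2l D0' hx) (lee_wpmul2l D0' hy))).
rewrite -!EFinM -EFinD lee_fin -mulrDr /qkernel /sqdiff /=.
(* [J] has side [3 Q.2 / 2 ^ K], six times [Q.2 / 2 ^ (K + 1)], and the latter is at most [|x - y|]
   by the choice of [K]. *)
have hE : J.2 / 6 <= enorm (x - y).
  apply: le_trans (norm_le_enorm _); apply: le_trans rK; rewrite dyadic_chain_side /=.
  rewrite le_eqVlt exprS; apply/orP; left; apply/eqP; field.
  by rewrite expf_neq0// gt_eqF.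
have J60 : 0 < J.2 / 6 by rewrite divr_gt0.
have p0 : 0 <= p by rewrite addr_ge0// mulr_ge0// ltW.
have hEp : (enorm (x - y) `^ p)^-1 <= 6 `^ p * J.2 `^ (- p).
  have -> : 6 `^ p * J.2 `^ (- p) = ((J.2 / 6) `^ p)^-1.
    by rewrite powRM ?(ltW J0)// invfM -!powRN -[6^-1]powR_inv1// -powRrM mulN1r opprK mulrC.
  rewrite lef_pV2 ?posrE ?powR_gt0// ?(lt_le_trans J60 hE)//.
  by apply: ge0_ler_powR; rewrite ?nnegrE ?(ltW J60) ?enorm_ge0.
rewrite mulrC; apply: (@le_trans _ _ (6 `^ p * J.2 `^ (- p) * `|u x - u y| ^+ 2)).
  by rewrite ler_wpM2r// exprn_ge0.
rewrite /D [6 `^ p * 2 * _]mulrAC -[leRHS]mulrA ler_wpM2l ?mulr_ge0 ?powR_ge0//.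
rewrite real_normK ?num_real//.
by have := sqr_ge0 (u x + u y - 2 * a); lra.
Qed.

Lemma integral_third_term J J' : 0 < J.2 -> 0 < J'.2 ->
  (\int[mu2]_z (third_term J J' z)%:E =
   (2 * third_weight J J' * J.2 ^+ n * J'.2 ^+ n)%:E)%E.
Proof.
move=> J0 J'0; have w0 := third_weight_ge0 J0 J'0.
have mc (I : cube R n) := measurable_cube_set I.
have int1 (A B : cube R n) : 0 < A.2 -> 0 < B.2 ->
    (\int[mu2]_z (\1_(cube_set A `*` cube_set B) z)%:E = (A.2 ^+ n * B.2 ^+ n)%:E)%E.
  move=> A0 B0; have mAB := measurableX (mc A) (mc B).
  rewrite integral_indic// setIT; apply: (etrans (product_measure1E _ _ (mc A) (mc B))).
  by rewrite EFinM; congr (_ * _)%E; exact: lebesgue_rV_cube.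
have m1 (A B : cube R n) : measurable_fun setT (fun z : 'rV[R]_n * 'rV[R]_n =>
    (\1_(cube_set A `*` cube_set B) z)%:E : \bar R).
  by apply: measurableT_comp => //; apply: measurable_indic; exact: measurableX.
under eq_integral => z _.
  rewrite (_ : (third_term J J' z)%:E = (third_weight J J')%:E *
    ((\1_(cube_set J' `*` cube_set J) z)%:E + (\1_(cube_set J `*` cube_set J') z)%:E))%E; last first.
    rewrite -EFinD -EFinM /third_term; congr (_ * (_ + _))%:E.
      by rewrite !indicE -natrM mulnb in_setX.
    by rewrite mulrC !indicE -natrM mulnb in_setX.
  over.
rewrite ge0_integralZl_EFin//; last 2 first.
- by move=> z _; rewrite adde_ge0.
- exact: emeasurable_funD.
rewrite ge0_integralD// !int1// -EFinD -EFinM; congr (_%:E); ring.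
Qed.

Definition chain_energy_const : R := 2 * third_const / (1 - th).

Lemma chain_energy_const_gt0 : 0 < chain_energy_const.
Proof.
by have /andP[_ ?] := th01; rewrite divr_gt0 ?subr_gt0// mulr_gt0 ?third_const_gt0.
Qed.

(** After the exchange of sums [J'] is fixed and [J] runs over its ancestors. The powers of [J.2]
    combine to the exponent [- p + alpha + n = - alpha], and this geometric sequence is dominated by
    the term of [J'] itself. *)
Lemma third_sum Q : 0 < Q.2 ->
  ((\esum_(J in dyadic Q)
     \esum_(J' in [set J' | dyadic Q J' /\ cube_set J' `<=` cube_set J])
       (2 * third_weight J J' * J.2 ^+ n * J'.2 ^+ n)%:E) <=
   chain_energy_const%:E *
   \esum_(J in dyadic Q) (s J * J.2 `^ (n%:R - 2 * alpha))%:E)%E.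
Proof.
move=> Q0; have pos J : dyadic Q J -> 0 < J.2 := dyadic_side_gt0 Q0.
have tw J J' : dyadic Q J -> dyadic Q J' ->
    (0 <= (2 * third_weight J J' * J.2 ^+ n * J'.2 ^+ n)%:E)%E.
  move=> /pos J0 /pos J'0; rewrite lee_fin mulr_ge0 ?exprn_ge0 ?(ltW J'0)//.
  by rewrite mulr_ge0 ?exprn_ge0 ?(ltW J0)// mulr_ge0// third_weight_ge0.
rewrite esum_exchange_dep//.
rewrite -esumZl ?(ltW chain_energy_const_gt0)//; last first.
  by move=> J /pos J0; rewrite lee_fin mulr_ge0 ?powR_ge0 ?s_ge0.
apply: le_esum => J' QJ'; have J'0 := pos _ QJ'.
pose c : R := 2 * third_const * (s J' * J'.2 `^ (n%:R - alpha)).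
have c0 : 0 <= c.
  apply: mulr_ge0; last by rewrite mulr_ge0 ?powR_ge0 ?s_ge0.
  by rewrite pmulr_rge0 ?ltW ?third_const_gt0.
rewrite (eq_esum (b := fun J => c%:E * (J.2 `^ (- alpha))%:E)%E); last first.
  move=> J [/pos J0 _]; rewrite -EFinM /third_weight /c; congr (_%:E).
  rewrite powRM ?invr_ge0 ?(ltW J0) ?(ltW J'0)// -[J'.2^-1]powR_inv1 ?(ltW J'0)// -powRrM mulN1r.
  rewrite -!powR_mulrn ?(ltW J0) ?(ltW J'0)//.
  have E (a : R) b c' : 0 < a -> a `^ b * a `^ c' = a `^ (b + c').
    by move=> a0; rewrite powRD// (lt0r_neq0 a0) implybT.
  have -> : J.2 `^ (- alpha) = J.2 `^ (- p) * (J.2 `^ alpha * J.2 `^ n%:R).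
    by rewrite !E//; congr (_ `^ _); ring.
  have -> : J'.2 `^ (n%:R - alpha) = J'.2 `^ (- alpha) * J'.2 `^ n%:R.
    by rewrite !E//; congr (_ `^ _); ring.
  ring.
rewrite esumZl//; last by move=> J _; rewrite lee_fin powR_ge0.
apply: (@le_trans _ _ (c%:E * (J'.2 `^ (- alpha) / (1 - th))%:E)%E).
  rewrite lee_wpmul2l ?lee_fin//.
  (* The ancestors of [J'] are among the cubes through its corner with weight at most that of [J'],
     the form in which [le_dyadic_sum_through] applies. *)
  apply: (@le_trans _ _ (\esum_(J in [set J | dyadic Q J /\ cube_set J J'.1 /\
      (J.2 `^ (- alpha) <= J'.2 `^ (- alpha))%R]) (J.2 `^ (- alpha))%:E)%E).
    apply: esum_subset => J [QJ JJ']; have J0 := pos _ QJ; split=> //; split.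
      by apply: JJ'; exact: corner_in_cube.
    have sJ : J'.2 <= J.2 by exact: cube_set_le_side.
    rewrite !powRN lef_pV2 ?posrE ?powR_gt0//.
    by apply: ge0_ler_powR; rewrite ?nnegrE ?(ltW J0) ?(ltW J'0) ?(ltW alpha_gt0).
  apply: le_dyadic_sum_through => //.
  - by apply: dyadic_sub QJ' _ _ => //; exact: corner_in_cube.
  - exact: powR_ge0.
  - by have /andP[h1 h2] := th01; rewrite (ltW h1) h2.
  - by move=> J _; exact: powR_ge0.
  - move=> I J /pos I0 IJ; rewrite (bisect_side IJ) powRM ?(ltW I0)//.
    have -> : 2^-1 `^ (- alpha) = th^-1 :> R.
      by rewrite -powR_inv1// -powRrM mulN1r -powRN.
    by rewrite mulrCA mulfV ?mulr1// gt_eqF// powR_gt0.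
rewrite -!EFinM lee_fin /c /chain_energy_const.
have -> : J'.2 `^ (n%:R - 2 * alpha) = J'.2 `^ (n%:R - alpha) * J'.2 `^ (- alpha).
  rewrite -powRD; first by congr (_ `^ _); ring.
  by rewrite (lt0r_neq0 J'0) implybT.
rewrite le_eqVlt; apply/orP; left; apply/eqP; ring.
Qed.

Lemma qenergy_le_dyadic Q : 0 < Q.2 ->
  (qenergy u p (cube_set Q) <= chain_energy_const%:E *
    \sum_(t : {ffun 'I_n -> bool})
      \esum_(J in dyadic (shifted_cube Q t)) (s J * J.2 `^ (n%:R - 2 * alpha))%:E)%E.
Proof.
move=> Q0; have mQ := @measurable_cube_set _ _ Q.
have S0 t : 0 < (shifted_cube Q t).2 by rewrite mulr_gt0.
have mt J J' : measurable_fun setT (fun z => (third_term J J' z)%:E).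
  have m1 (A : cube R n) : measurable_fun setT (\1_(cube_set A) : 'rV[R]_n -> R).
    by apply: measurable_indic; exact: measurable_cube_set.
  apply: measurableT_comp => //; apply: measurable_funM => //.
  by apply: measurable_funD; apply: measurable_funM; apply: measurableT_comp.
have tt0 t J J' z : dyadic (shifted_cube Q t) J -> dyadic (shifted_cube Q t) J' ->
    (0 <= (third_term J J' z)%:E)%E.
  move=> /(dyadic_side_gt0 (S0 t)) J0 /(dyadic_side_gt0 (S0 t)) J'0.
  by rewrite lee_fin third_term_ge0.
pose S t J := [set J' | dyadic (shifted_cube Q t) J' /\ cube_set J' `<=` cube_set J].
have cS t J : countable (S t J).
  by apply: sub_countable (countable_dyadic (shifted_cube Q t)); apply: subset_card_le => ? [].
pose F t z : \bar R := (\esum_(J in dyadic (shifted_cube Q t))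
  \esum_(J' in S t J) (third_term J J' z)%:E)%E.
have mF1 t J : dyadic (shifted_cube Q t) J ->
    measurable_fun setT (fun z => (\esum_(J' in S t J) (third_term J J' z)%:E)%E).
  by move=> QJ; apply: emeasurable_fun_esum => // J' z [QJ' _] _; exact: (tt0 t).
have F10 t J z : dyadic (shifted_cube Q t) J ->
    (0 <= \esum_(J' in S t J) (third_term J J' z)%:E)%E.
  by move=> QJ; apply: esum_ge0 => J' [QJ' _]; exact: (tt0 t).
have mF t : measurable_fun setT (F t).
  apply: emeasurable_fun_esum => //; [exact: countable_dyadic|exact: mF1|].
  by move=> J z QJ _; exact: F10.
have F0 t z : (0 <= F t z)%E by apply: esum_ge0 => J; exact: F10.
have mQQ : measurable (cube_set Q `*` cube_set Q) by exact: measurableX.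
apply: (@le_trans _ _ (\int[mu2]_(z in cube_set Q `*` cube_set Q) (\sum_t F t z))%E).
  apply: ge0_le_integral => //.
  - by move=> z _; rewrite lee_fin qkernel_ge0.
  - by apply: measurable_funTS; apply: measurableT_comp => //; exact: measurable_qkernel.
  - by apply: measurable_funTS; apply: emeasurable_sum.
  - by move=> z [? ?]; exact: qkernel_third.
(* Enlarging the domain to all pairs of points makes the integral of each term explicit. *)
apply: (@le_trans _ _ (\int[mu2]_z (\sum_t F t z))%E).
  apply: ge0_subset_integral => //; first exact: emeasurable_sum.
  by move=> z _; exact: sume_ge0.
rewrite ge0_integral_sum// ge0_sume_distrr; last first.
  move=> t _; apply: esum_ge0 => J /(dyadic_side_gt0 (S0 t)) J0.
  by rewrite lee_fin mulr_ge0 ?powR_ge0 ?s_ge0.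
apply: lee_sum => t _; apply: le_trans (third_sum (S0 t)).
rewrite /F ge0_integral_esum//; last 3 first.
- exact: countable_dyadic.
- exact: mF1.
- by move=> J z QJ _; exact: F10.
apply: le_esum => J QJ; rewrite ge0_integral_esum//; last first.
  by move=> J' z [QJ' _] _; exact: (tt0 t).
apply: le_esum => J' [QJ' _]; rewrite integral_third_term//.
- exact: dyadic_side_gt0 QJ.
- exact: dyadic_side_gt0 QJ'.
Qed.

End chain_energy.

(** * The gauge *)

(** The image of [J] under the inverse of [phi], in the preimage form that occurs in
    [gauge_admissible]. *)
Definition quasicube (R : realType) (n : nat) (phi : 'rV[R]_n -> 'rV[R]_n)
    (J : cube R n) : set 'rV[R]_n := phi @^-1` cube_set J.

Section gauge.
Context (R : realType) (n : nat) (phi : 'rV[R]_n -> 'rV[R]_n) (beta : R).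
Hypothesis n_gt0 : (0 < n)%N.
Local Notation V J := (volume (quasicube phi J)).
Hypothesis V_gt0 : forall J : cube R n, 0 < J.2 -> 0 < V J.
Implicit Types (Q I J : cube R n).

(** Admissibility at [J = Q] involves the single ancestor [Q], with ratio 1; hence [lambda Q >= 1],
    and this is one term of the sum. The bound keeps constants multiplied by the gauge positive. *)
Lemma gauge_on_ge1 Q : 0 < Q.2 -> (1 <= gauge_on phi beta Q)%E.
Proof.
move=> Q0; apply: le_ereal_inf_tmp => _ [lambda [l0 ladm] <-].
have vQ : volume (cube_set Q) != 0 by rewrite volume_cube// gt_eqF// exprn_gt0.
have lQ : (1 <= (lambda Q)%:E)%E.
  have := ladm _ (dyadic_refl Q).
  have -> : [set I | dyadic Q I /\ cube_set Q `<=` cube_set I] = [set Q].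
    apply/seteqP; split=> [I [QI /(dyadic_sub_self n_gt0 Q0 QI)]//|I ->].
    by split=> //; exact: dyadic_refl.
  rewrite esum_set1; last by rewrite lee_fin mulr_ge0 ?powR_ge0// l0//; exact: dyadic_refl.
  by rewrite !divff ?mul1r ?powR1 ?mulr1// gt_eqF// V_gt0.
apply: (le_trans lQ).
have -> : (lambda Q)%:E =
    (\esum_(I in [set Q]) (lambda I * (volume (cube_set I) / volume (cube_set Q)) `^ beta)%:E)%E.
  rewrite esum_set1; last by rewrite lee_fin mulr_ge0 ?powR_ge0// l0//; exact: dyadic_refl.
  by rewrite divff// powR1 mulr1.
by apply: esum_subset => I ->; exact: dyadic_refl.
Qed.

Lemma gauge_ge1 : (1 <= gauge phi beta)%E.
Proof.
pose Q : cube R n := (0, 1); have Q0 : 0 < Q.2 by rewrite /= ltr01.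
by apply: (le_trans (gauge_on_ge1 Q0)); apply: ereal_sup_ubound; exists Q.
Qed.

(** The product of [s J |J|^beta] and the admissibility term of [I] is [b I J], in which [|J|] has
    cancelled. After the exchange of sums the hypothesis bounds the inner sum by [N * a I]. The
    strict inequality with [G] provides a competitor [lambda], as the infimum need not be
    attained. *)
Lemma gauge_transfer Q (s : cube R n -> R) (N G : R) : 0 < Q.2 ->
  (forall J, dyadic Q J -> 0 <= s J) -> 0 <= N ->
  (forall I, dyadic Q I ->
    (\esum_(J in [set J | dyadic Q J /\ cube_set J `<=` cube_set I])
       (V J `^ beta * s J)%:E <= (N * V I `^ beta)%:E)%E) ->
  (gauge_on phi beta Q < G%:E)%E ->
  (\esum_(J in dyadic Q) (s J * (J.2 ^+ n) `^ beta)%:E <=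
    (N * G * (Q.2 ^+ n) `^ beta)%:E)%E.
Proof.
move=> Q0 s0 N0 hN /ereal_inf_lt[_ [lambda [l0 ladm] <-] LG].
have pos J : dyadic Q J -> 0 < J.2 := dyadic_side_gt0 Q0.
have vol J : dyadic Q J -> volume (cube_set J) = J.2 ^+ n by move=> /pos; exact: volume_cube.
pose a I : R := lambda I * (I.2 ^+ n) `^ beta.
have a0 I : dyadic Q I -> 0 <= a I by move=> /l0 ?; rewrite mulr_ge0 ?powR_ge0.
pose b I J : \bar R := ((a I / V I `^ beta)%:E * (V J `^ beta * s J)%:E)%E.
have b0 J I : dyadic Q J -> dyadic Q I -> (0 <= b I J)%E.
  move=> QJ QI; rewrite /b -EFinM lee_fin mulr_ge0//.
    by rewrite divr_ge0 ?powR_ge0 ?a0.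
  by rewrite mulr_ge0 ?powR_ge0 ?s0.
apply: (@le_trans _ _ (\esum_(J in dyadic Q)
    \esum_(I in [set I | dyadic Q I /\ cube_set J `<=` cube_set I]) b I J)%E).
  apply: le_esum => J QJ; have J0 := pos _ QJ; have VJ0 := V_gt0 J0.
  have Jn : 0 < J.2 ^+ n by rewrite exprn_gt0.
  have c0 : 0 <= s J * (J.2 ^+ n) `^ beta by rewrite mulr_ge0 ?powR_ge0 ?s0.
  have -> : (\esum_(I in [set I | dyadic Q I /\ cube_set J `<=` cube_set I]) b I J =
      (s J * (J.2 ^+ n) `^ beta)%:E *
      \esum_(I in [set I | dyadic Q I /\ cube_set J `<=` cube_set I])
        (lambda I * (volume (cube_set I) / volume (cube_set J) *
          (volume (phi @^-1` cube_set J) / volume (phi @^-1` cube_set I))) `^ beta)%:E)%E.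
    rewrite -esumZl//; last first.
      by move=> I [QI _]; rewrite lee_fin mulr_ge0 ?powR_ge0 ?l0.
    apply: eq_esum => I [QI _]; have I0 := pos _ QI; have VI0 := V_gt0 I0.
    have In : 0 < I.2 ^+ n by rewrite exprn_gt0.
    rewrite /b -!EFinM (vol _ QI) (vol _ QJ) -/(quasicube phi J) -/(quasicube phi I) /a.
    congr (_%:E); have inv x : 0 < x -> x^-1 `^ beta = (x `^ beta)^-1.
      by move=> x0; rewrite -[x^-1]powR_inv1 ?(ltW x0)// -powRrM mulN1r powRN.
    rewrite !powRM ?mulr_ge0 ?invr_ge0 ?(ltW VJ0) ?(ltW VI0) ?(ltW In) ?(ltW Jn)// !inv//.
    by field; rewrite !gt_eqF ?powR_gt0.
  by rewrite -[leLHS]mule1 lee_wpmul2l ?lee_fin// ladm.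
rewrite esum_exchange_dep//.
apply: (@le_trans _ _ (\esum_(I in dyadic Q) (N * a I)%:E)%E).
  apply: le_esum => I QI; have VI0 := V_gt0 (pos _ QI).
  rewrite /b esumZl; last 2 first.
  - by rewrite divr_ge0 ?powR_ge0 ?a0.
  - by move=> J [QJ _]; rewrite lee_fin mulr_ge0 ?powR_ge0 ?s0.
  have aV : (0 <= (a I / V I `^ beta)%:E)%E by rewrite lee_fin divr_ge0 ?powR_ge0 ?a0.
  apply: (le_trans (lee_wpmul2l aV (hN _ QI))).
  rewrite -EFinM lee_fin le_eqVlt; apply/orP; left; apply/eqP.
  by field; rewrite gt_eqF ?powR_gt0.
have Qn : 0 < Q.2 ^+ n by rewrite exprn_gt0.
have NQ : 0 <= N * (Q.2 ^+ n) `^ beta by rewrite mulr_ge0 ?powR_ge0.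
rewrite (eq_esum (b := fun I => (N * (Q.2 ^+ n) `^ beta)%:E *
   (lambda I * (volume (cube_set I) / volume (cube_set Q)) `^ beta)%:E)%E); last first.
  move=> I QI; have I0 := pos _ QI.
  rewrite -EFinM (vol _ QI) (vol _ (dyadic_refl Q)) /a; congr (_%:E).
  rewrite powRM ?exprn_ge0 ?invr_ge0 ?exprn_ge0 ?(ltW I0) ?(ltW Q0)//.
  rewrite -[(Q.2 ^+ n)^-1]powR_inv1 ?(ltW Qn)// -[in RHS]powRrM mulN1r powRN.
  by field; rewrite gt_eqF ?powR_gt0.
rewrite esumZl//; last by move=> I QI; rewrite lee_fin mulr_ge0 ?powR_ge0 ?l0.
have -> : N * G * (Q.2 ^+ n) `^ beta = N * (Q.2 ^+ n) `^ beta * G by ring.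
by rewrite (EFinM (N * (Q.2 ^+ n) `^ beta) G) lee_wpmul2l ?lee_fin// ltW.
Qed.

End gauge.

(** * The seminorm of a composition *)

Section Qnorm.
Context (R : realType) (n : nat) (alpha : R).
Hypothesis n_gt0 : (0 < n)%N.
Local Notation p := (n%:R + 2 * alpha).
Local Notation beta := (1 - 2 * alpha / n%:R).
Implicit Types (f : 'rV[R]_n -> R).

Lemma Qnorm_ge0 f : (0 <= Qnorm alpha f)%E.
Proof.
pose Q : cube R n := (0, 1).
apply: le_trans (ereal_sup_ubound _); last by exists Q => //=; rewrite /cubes /= ltr01.
exact: sqrte_ge0.
Qed.

Lemma qenergy_ge0 f (A : set 'rV[R]_n) : (0 <= qenergy f p A)%E.
Proof. by apply: integral_ge0 => z _; rewrite lee_fin qkernel_ge0. Qed.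

Lemma qenergy_le_Qnorm f (Q : cube R n) (M : R) : continuous f -> 0 < Q.2 ->
  (Qnorm alpha f ^+ 2 <= M%:E)%E ->
  (qenergy f p (cube_set Q) <= (M * Q.2 `^ (n%:R * beta))%:E)%E.
Proof.
move=> f_cts Q0 fM; have Qn : 0 < Q.2 ^+ n by rewrite exprn_gt0.
have w0 : 0 < (Q.2 ^+ n) `^ (2 * alpha / n%:R - 1) by rewrite powR_gt0.
have : (((Q.2 ^+ n) `^ (2 * alpha / n%:R - 1))%:E * qenergy f p (cube_set Q) <= M%:E)%E.
  apply: le_trans fM.
  have X0 : (0 <= ((Q.2 ^+ n) `^ (2 * alpha / n%:R - 1))%:E * qenergy f p (cube_set Q))%E.
    by rewrite mule_ge0 ?qenergy_ge0// lee_fin ltW.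
  rewrite -(sqr_sqrte X0) lee_sqr ?sqrte_ge0 ?Qnorm_ge0//.
  apply: ereal_sup_ubound; exists Q => //.
  by rewrite volume_cube// qenergyE//; exact: measurable_cube_set.
rewrite -lee_pdivlMl// => /le_trans; apply.
rewrite -EFinM lee_fin mulrC -powRN opprB powRrM powR_mulrn ?(ltW Q0)//.
Qed.

Lemma Qnorm_le_qenergy f (M : R) : continuous f -> 0 <= M ->
  (forall Q : cube R n, 0 < Q.2 ->
    (qenergy f p (cube_set Q) <= (M * (Q.2 ^+ n) `^ beta)%:E)%E) ->
  (Qnorm alpha f ^+ 2 <= M%:E)%E.
Proof.
move=> f_cts M0 h.
have M0' : (0 <= M%:E :> \bar R)%E by rewrite lee_fin.
rewrite -(sqr_sqrte M0') lee_sqr ?sqrte_ge0 ?Qnorm_ge0//.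
apply: ge_ereal_sup => _ [Q Q0 <-].
have Qn : 0 < Q.2 ^+ n by rewrite exprn_gt0.
rewrite lee_sqrt//= -qenergyE//; last exact: measurable_cube_set.
rewrite volume_cube//.
have w0 : (0 <= ((Q.2 ^+ n) `^ (2 * alpha / n%:R - 1))%:E)%E by rewrite lee_fin powR_ge0.
apply: (le_trans (lee_wpmul2l w0 (h Q Q0))).
rewrite -EFinM lee_fin mulrCA -powRD; last by rewrite (lt0r_neq0 Qn) implybT.
rewrite [X in _ `^ X](_ : _ = 0) ?powRr0 ?mulr1//; ring.
Qed.

End Qnorm.

(** If [g] exceeded its average [c] at every point of [A], then [g - c] would be positive with
    integral 0, hence 0 almost everywhere, although [A] has positive measure. *)
Lemma exists_le_average d (T : measurableType d) (R : realType)
    (mu : {measure set T -> \bar R}) (A : set T) (v : R) (g : T -> \bar R) :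
  measurable A -> mu A = v%:E -> 0 < v -> measurable_fun A g ->
  (forall x, A x -> 0 <= g x)%E ->
  exists2 x, A x & (v%:E * g x <= \int[mu]_(y in A) g y)%E.
Proof.
move=> mA muA v0 mg g0; apply: contrapT => none.
have gt x : A x -> (\int[mu]_(y in A) g y < v%:E * g x)%E.
  by move=> Ax; rewrite ltNge; apply/negP => h; apply: none; exists x.
have [x0 Ax0] : A !=set0.
  apply/set0P/eqP => A0; move: muA v0; rewrite A0 measure0 => -[<-]; by rewrite ltxx.
have I0 : (0 <= \int[mu]_(y in A) g y)%E by exact: integral_ge0.
have Ifin : (\int[mu]_(y in A) g y \is a fin_num)%E.
  by rewrite ge0_fin_numE// (lt_le_trans (gt _ Ax0))// leey.
pose c := fine (\int[mu]_(y in A) g y) / v.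
have c0 : 0 <= c by exact: divr_ge0 (fine_ge0 I0) (ltW v0).
have cg x : A x -> (c%:E < g x)%E.
  by move=> /gt; rewrite -(fineK Ifin) muleC -lte_pdivrMr// -EFinM.
have gc0 x : A x -> (0 <= g x - c%:E)%E by move=> /cg /ltW; rewrite leeBrDr// add0e.
have mgc : measurable_fun A (fun x => g x - c%:E)%E.
  by apply: emeasurable_funB.
have int0 : (\int[mu]_(x in A) (g x - c%:E) = 0)%E.
  have : (\int[mu]_(x in A) g x = \int[mu]_(x in A) (g x - c%:E) + c%:E * v%:E)%E.
    rewrite -muA -integral_cst// -ge0_integralD//.
    by apply: eq_integral => x _; rewrite subeK.
  rewrite -EFinM divfK ?gt_eqF// fineK//.
  move: Ifin; case: (\int[mu]_(x in A) g x)%E => // r _.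
  case: (\int[mu]_(x in A) _)%E => //= r'; rewrite -EFinD => -[].
  by rewrite -[LHS]add0r => /addIr <-.
have : ae_eq mu A (fun x => g x - c%:E)%E (cst 0%E).
  apply/ae_eq_integral_abs => //; rewrite -[RHS]int0.
  by apply: eq_integral => x /[!inE] Ax; rewrite gee0_abs// gc0.
move=> [N [mN N0 AN]].
have : (mu A <= mu N)%E.
  rewrite le_measure ?inE// => x Ax; apply: AN => /= /(_ Ax) h.
  by have := cg _ Ax; rewrite -sube_gt0 h ltxx.
by rewrite N0 muA lee_fin leNgt v0.
Qed.

(** For infinite [X] the right-hand side is [+oo] because [c] is positive; estimates thus reduce to
    finite seminorms. *)
Lemma lee_mulr_of_real (R : realType) (c : R) (X Y : \bar R) : 0 < c ->
  (0 <= X)%E ->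
  (forall M, 0 <= M -> (X <= M%:E)%E -> (Y <= (c * M)%:E)%E) ->
  (Y <= c%:E * X)%E.
Proof.
move=> c0; case: X => [x|_ _|]//; last by rewrite gt0_muley ?leey.
by rewrite lee_fin => x0; apply.
Qed.

(** * Shape and volume of quasicubes *)

Section quasicube.
Context (R : realType) (n : nat) (phi psi : 'rV[R]_n -> 'rV[R]_n) (H : R).
Hypothesis n_gt0 : (0 < n)%N.
Hypothesis phi_cts : continuous phi.
Hypothesis phiK : cancel phi psi.
Hypothesis psiK : cancel psi phi.
Hypothesis H1 : 1 <= H.
Hypothesis psi_wqs : weakly_quasisymmetric psi H.
Local Notation mu := (lebesgue_rV R n).
Local Notation mu2 := (lebesgue_rV R n \x lebesgue_rV R n)%E.
Local Notation qc := (quasicube phi).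
Local Notation V J := (volume (qc J)).
Implicit Types (I J Q : cube R n).

Definition cube_center J : 'rV[R]_n := J.1 + const_mx (J.2 / 2).
(** The reference length of a quasicube, which lies between the balls of radii [D J / H] and
    [H * D J] around the image of the centre. *)
Definition quasicube_radius J := `|psi (cube_center J) - psi J.1|.
Local Notation D := quasicube_radius.

Let H0 : 0 < H. Proof. exact: lt_le_trans H1. Qed.

Lemma norm_center_corner J : 0 < J.2 -> `|cube_center J - J.1| = J.2 / 2.
Proof.
move=> J0; have J2 : 0 < J.2 / 2 by rewrite divr_gt0.
rewrite /cube_center addrC addKr; apply/eqP; rewrite eq_le; apply/andP; split.
  by apply: rV_norm_leP => [|i]; rewrite ?mxE ?gtr0_norm// ltW.
have := ler_coord_norm (const_mx (J.2 / 2) : 'rV[R]_n) (Ordinal n_gt0).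
by rewrite mxE gtr0_norm.
Qed.

Lemma mem_cube_near_center J x : `|cube_center J - x| < J.2 / 2 -> cube_set J x.
Proof.
move=> h i; have := le_lt_trans (ler_coord_norm _ i) h; rewrite !mxE ltr_norml => /andP[? ?].
by apply/andP; split; lra.
Qed.

Lemma cube_near_center J x : cube_set J x -> `|cube_center J - x| <= J.2 / 2.
Proof.
move=> Jx; apply: rV_norm_leP => [|i].
  by have /andP[] := Jx (Ordinal n_gt0); lra.
by have /andP[? ?] := Jx i; rewrite !mxE ler_norml; apply/andP; split; lra.
Qed.

Lemma quasicube_radius_gt0 J : 0 < J.2 -> 0 < D J.
Proof.
move=> J0; rewrite normr_gt0 subr_eq0 (can_eq psiK) -subr_eq0 -normr_gt0.
by rewrite norm_center_corner// divr_gt0.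
Qed.

Lemma psi_near_center J y : 0 < J.2 -> `|cube_center J - y| <= 2 * J.2 ->
  `|psi (cube_center J) - psi y| <= H * D J.
Proof.
move=> J0 yJ; apply: psi_wqs; rewrite norm_center_corner//.
by apply: (le_trans yJ); lra.
Qed.

Lemma quasicube_outer J w : 0 < J.2 -> qc J w ->
  `|psi (cube_center J) - w| <= H * D J.
Proof.
move=> J0 /cube_near_center wJ; rewrite -(phiK w); apply: psi_near_center => //.
by apply: (le_trans wJ); lra.
Qed.

(** A point outside [J] is at least as far from the centre as the corner is, so weak quasisymmetry
    bounds the radius by [H] times the distance of the images. *)
Lemma quasicube_inner J w : 0 < J.2 -> `|psi (cube_center J) - w| < D J / H ->
  qc J w.
Proof.
move=> J0; rewrite ltr_pdivlMr// => wJ; apply: mem_cube_near_center.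
rewrite ltNge; apply/negP => h; move: wJ; rewrite ltNge => /negP; apply.
rewrite mulrC -[w]phiK; apply: psi_wqs.
by rewrite norm_center_corner//; apply: (le_trans h); rewrite ler_peMl// ler1n.
Qed.

(** The half-side [D J / (2 H)] keeps this cube inside the open ball of radius [D J / H]. *)
Definition inner_cube J : cube R n :=
  (psi (cube_center J) - const_mx (D J / H / 2), D J / H).

(** The half-side is twice the outer radius [H * D J], so that the closed ball fits into a half-open
    cube. *)
Definition outer_cube J : cube R n :=
  (psi (cube_center J) - const_mx (2 * (H * D J)), 4 * (H * D J)).

Lemma measurable_quasicube J : measurable (qc J).
Proof.
rewrite -[X in measurable X]setTI.
by apply: (continuous_measurable_rV_rV phi_cts) => //; exact: measurable_cube_set.
Qed.

Lemma inner_cube_sub J : 0 < J.2 -> cube_set (inner_cube J) `<=` qc J.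
Proof.
move=> J0 w Iw; have D0 := quasicube_radius_gt0 J0.
have DH0 : 0 < D J / H by rewrite divr_gt0.
apply: quasicube_inner => //; apply: rV_norm_ltP => // i.
have := Iw i; rewrite !mxE/= => /andP[? ?]; rewrite ltr_norml.
by apply/andP; split; lra.
Qed.

Lemma outer_cube_sup J : 0 < J.2 -> qc J `<=` cube_set (outer_cube J).
Proof.
move=> J0 w /(quasicube_outer J0) wJ i; have D0 := quasicube_radius_gt0 J0.
have HD0 : 0 < H * D J by rewrite mulr_gt0.
have := le_trans (ler_coord_norm _ i) wJ; rewrite !mxE/= ler_norml => /andP[? ?].
by apply/andP; split; lra.
Qed.

Lemma lebesgue_quasicube_fin J : 0 < J.2 -> mu (qc J) = (V J)%:E.
Proof.
move=> J0; rewrite /volume fineK// ge0_fin_numE ?measure_ge0//.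
have O0 : 0 < (outer_cube J).2.
  by rewrite !mulr_gt0// quasicube_radius_gt0.
apply: (@le_lt_trans _ _ (mu (cube_set (outer_cube J)))).
  rewrite le_measure ?inE//; [exact: measurable_quasicube|exact: measurable_cube_set|].
  exact: outer_cube_sup.
by rewrite lebesgue_rV_cube// ltry.
Qed.

Lemma quasicube_volume_ge J : 0 < J.2 -> (D J / H) ^+ n <= V J.
Proof.
move=> J0; have D0 := quasicube_radius_gt0 J0.
rewrite -lee_fin -lebesgue_quasicube_fin// -(@lebesgue_rV_cube _ _ (inner_cube J)) ?divr_gt0//.
rewrite le_measure ?inE//; [exact: measurable_cube_set|exact: measurable_quasicube|].
exact: inner_cube_sub.
Qed.

Lemma quasicube_volume_le J : 0 < J.2 -> V J <= (4 * (H * D J)) ^+ n.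
Proof.
move=> J0; have D0 := quasicube_radius_gt0 J0.
rewrite -lee_fin -lebesgue_quasicube_fin//.
rewrite -(@lebesgue_rV_cube _ _ (outer_cube J)) ?mulr_gt0//.
rewrite le_measure ?inE//; [exact: measurable_quasicube|exact: measurable_cube_set|].
exact: outer_cube_sup.
Qed.

Lemma quasicube_volume_gt0 J : 0 < J.2 -> 0 < V J.
Proof.
move=> J0; apply: lt_le_trans (quasicube_volume_ge J0).
by rewrite exprn_gt0// divr_gt0// quasicube_radius_gt0.
Qed.

Lemma outer_cube_volume J : 0 < J.2 ->
  (4 * (H * D J)) ^+ n <= (4 * H ^+ 2) ^+ n * V J.
Proof.
move=> J0; have D0 := quasicube_radius_gt0 J0.
apply: le_trans (ler_wpM2l _ (quasicube_volume_ge J0)).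
  rewrite -exprMn lerXn2r// ?nnegrE ?mulr_ge0 ?(ltW H0) ?(ltW D0)//.
    by rewrite ?exprn_ge0 ?mulr_ge0 ?invr_ge0 ?(ltW H0) ?(ltW D0)//.
  by rewrite le_eqVlt; apply/orP; left; apply/eqP; field; rewrite gt_eqF.
by rewrite exprn_ge0// mulr_ge0// exprn_ge0// ltW.
Qed.

Lemma quasicube_diam J x y : 0 < J.2 -> qc J x -> qc J y ->
  `|x - y| ^+ n <= (4 * H ^+ 2) ^+ n * V J.
Proof.
move=> J0 /(quasicube_outer J0) xJ /(quasicube_outer J0) yJ.
apply: le_trans (outer_cube_volume J0).
have D0 := quasicube_radius_gt0 J0; have HD0 : 0 < H * D J by rewrite mulr_gt0.
have HD4 : 0 <= 4 * (H * D J) by rewrite mulr_ge0// ltW.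
rewrite lerXn2r ?nnegrE//.
apply: (le_trans (ler_distD (psi (cube_center J)) _ _)).
by rewrite (distrC x); lra.
Qed.

(* 8 H^3 is the product of 4 H for the outer cube of the parent, 2 H for the ratio
   of the radii, and H for the inner cube of the child. *)
Definition child_ratio : R := ((8 * H ^+ 3) ^+ n)^-1.

Lemma child_ratio_gt0 : 0 < child_ratio.
Proof. by rewrite invr_gt0 exprn_gt0// mulr_gt0// exprn_gt0. Qed.

(** The centre and the corner of [I] are both within [2 * J.2] of the centre of [J], hence their
    images are both within [H * D J] of its image. *)
Lemma quasicube_radius_child I J : 0 < I.2 -> bisect I J -> D I <= 2 * (H * D J).
Proof.
move=> I0 IJ; have J0 : 0 < J.2 by rewrite (bisect_side IJ) divr_gt0.
have sub y : `|cube_center I - y| <= I.2 / 2 -> `|cube_center J - y| <= 2 * J.2.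
  move=> Iy; have cJ : cube_set I (cube_center J).
    apply: (bisect_sub I0 IJ); apply: mem_cube_near_center.
    by rewrite subrr normr0 divr_gt0.
  apply: (le_trans (ler_distD (cube_center I) _ _)).
  have := cube_near_center cJ; rewrite distrC (bisect_side IJ); lra.
have h1 : `|psi (cube_center J) - psi (cube_center I)| <= H * D J.
  by apply: psi_near_center => //; apply: sub; rewrite subrr normr0 divr_ge0// ltW.
have h2 : `|psi (cube_center J) - psi I.1| <= H * D J.
  by apply: psi_near_center => //; apply: sub; rewrite norm_center_corner.
apply: (le_trans (ler_distD (psi (cube_center J)) _ _)).
by rewrite (distrC (psi (cube_center I))); lra.
Qed.

Lemma quasicube_child_ge I J : 0 < I.2 -> bisect I J -> child_ratio * V I <= V J.
Proof.
move=> I0 IJ; have J0 : 0 < J.2 by rewrite (bisect_side IJ) divr_gt0.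
have DJ0 := quasicube_radius_gt0 J0; have DI0 := quasicube_radius_gt0 I0.
rewrite /child_ratio ler_pdivrMl ?exprn_gt0 ?mulr_gt0 ?exprn_gt0//.
apply: le_trans (ler_wpM2l _ (quasicube_volume_ge J0)); last first.
  by rewrite exprn_ge0// mulr_ge0// exprn_ge0// ltW.
apply: (le_trans (quasicube_volume_le I0)).
rewrite -exprMn lerXn2r// ?nnegrE ?mulr_ge0 ?exprn_ge0 ?invr_ge0 ?(ltW H0) ?(ltW DJ0) ?(ltW DI0)//.
have -> : 8 * H ^+ 3 * (D J / H) = 4 * (H * (2 * (H * D J))).
  by field; rewrite gt_eqF.
by rewrite ler_pM2l// ler_pM2l// quasicube_radius_child.
Qed.

Lemma bisect_sibling I J : 0 < I.2 -> bisect I J ->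
  exists2 S, bisect I S & cube_set J `&` cube_set S = set0.
Proof.
move=> I0 IJ; case: (IJ) => e _ eJ.
(* Flipping every binary digit gives a different child because [n > 0], and different children are
   disjoint. *)
pose S : cube R n := (I.1 + (I.2 / 2) *: (\row_i (~~ e i)%:R), I.2 / 2).
have IS : bisect I S.
  exists [ffun i => ~~ e i] => //; congr (_ + _ *: _, _).
  by apply/rowP => i; rewrite !mxE ffunE.
exists S => //; rewrite -subset0 => x [Jx Sx].
have := bisect_unique IS Sx; rewrite -(bisect_unique IJ Jx) -eJ => -[/addrI].
have I2 : I.2 / 2 != 0 by rewrite gt_eqF// divr_gt0.
move=> /(scalerI I2)/rowP/(_ (Ordinal n_gt0)); rewrite !mxE.
by case: (e _) => /= /eqP; rewrite ?oner_eq0 // eq_sym oner_eq0.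
Qed.

(** A sibling disjoint from [J] takes at least the share [child_ratio] of the volume. This is the
    geometric decrease along chains. *)
Lemma quasicube_child_le I J : 0 < I.2 -> bisect I J ->
  V J <= (1 - child_ratio) * V I.
Proof.
move=> I0 IJ; have [S IS JS] := bisect_sibling I0 IJ.
have J0 : 0 < J.2 by rewrite (bisect_side IJ) divr_gt0.
have S0 : 0 < S.2 by rewrite (bisect_side IS) divr_gt0.
have : V J + V S <= V I.
  rewrite -lee_fin EFinD -!lebesgue_quasicube_fin//.
  rewrite -measureU//; [|exact: measurable_quasicube|exact: measurable_quasicube|].
    rewrite le_measure ?inE//.
    - by apply: measurableU; exact: measurable_quasicube.
    - exact: measurable_quasicube.
    - by rewrite subUset; split; apply: preimage_subset; exact: bisect_sub.
  by rewrite -preimage_setI JS preimage_set0.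
have := quasicube_child_ge I0 IS; lra.
Qed.

Lemma child_ratio_lt1 : child_ratio < 1.
Proof.
have H3 : 1 <= H ^+ 3 by rewrite exprn_ege1.
have H8 : 1 < 8 * H ^+ 3 by lra.
by rewrite invf_lt1 ?exprn_gt0 ?(lt_trans _ H8)// exprn_egt1// -lt0n.
Qed.

(** * Mean oscillation on quasicubes *)

Context (alpha : R) (f : 'rV[R]_n -> R).
Hypothesis alpha_gt0 : 0 < alpha.
Hypothesis alpha_lt : alpha < n%:R / 2.
Hypothesis f_cts : continuous f.
Local Notation beta := (1 - 2 * alpha / n%:R).
Local Notation gamma := (1 + 2 * alpha / n%:R).
Local Notation p := (n%:R + 2 * alpha).
Local Notation Cd := ((4 * H ^+ 2) ^+ n).
Local Notation theta := ((1 - child_ratio) `^ gamma).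

Definition qosc J : \bar R :=
  ((V J ^- 2)%:E * \int[mu2]_(z in qc J `*` qc J) (sqdiff f z)%:E)%E.

(** [Cd ^ gamma] comes from the diameter bound, [n ^ p] from comparing the Euclidean and the sup
    norm, and [1 / (1 - theta)] from the geometric sum. *)
Definition kernel_const : R := Cd `^ gamma * n%:R `^ p / (1 - theta).

Let n0 : 0 < n%:R :> R. Proof. by rewrite ltr0n. Qed.
Let gamma0 : 0 < gamma. Proof. by rewrite ltr_wpDr// divr_ge0 ?mulr_ge0// ltW. Qed.
Let beta0 : 0 < beta.
Proof. by rewrite subr_gt0 ltr_pdivrMr// mul1r mulrC -ltr_pdivlMr. Qed.
Let Cd0 : 0 < Cd. Proof. by rewrite exprn_gt0// mulr_gt0// exprn_gt0. Qed.

Lemma chain_rate_bounds : 0 <= theta < 1.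
Proof.
rewrite powR_ge0/=.
have := @gt0_ltr_powR _ _ gamma0 (1 - child_ratio) 1.
by rewrite powR1; apply; rewrite ?nnegrE ?subr_ge0 ?(ltW child_ratio_lt1)// gtrBl child_ratio_gt0.
Qed.

Lemma kernel_const_gt0 : 0 < kernel_const.
Proof.
by have /andP[_ t1] := chain_rate_bounds; rewrite divr_gt0 ?subr_gt0// mulr_gt0 ?powR_gt0.
Qed.

Lemma qosc_ge0 J : (0 <= qosc J)%E.
Proof.
apply: mule_ge0; first by rewrite lee_fin invr_ge0 exprn_ge0// fine_ge0.
by apply: integral_ge0 => z _; rewrite lee_fin sqdiff_ge0.
Qed.

(** A quasicube containing [x] and [y] has volume at least [|x - y|^n / Cd], so its weight is at
    most [M]. The weights grow geometrically along the chain of [phi x], so their sum is at most a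
    multiple of [M], and [n * gamma = p] turns [M] into the kernel. *)
Lemma quasicube_kernel_sum Q I z : 0 < Q.2 -> dyadic Q I ->
  (\esum_(J in [set J | dyadic Q J /\ cube_set J `<=` cube_set I])
     ((V J `^ (- gamma))%:E * ((EFin \o sqdiff f) \_ (qc J `*` qc J)) z)
   <= ((fun z => (kernel_const * qkernel f p z)%:E) \_ (qc I `*` qc I)) z)%E.
Proof.
move=> Q0 QI; set S := [set J | _].
have zero : sqdiff f z = 0 \/ ~ (qc I `*` qc I) z ->
    (\esum_(J in S) ((V J `^ (- gamma))%:E * ((EFin \o sqdiff f) \_ (qc J `*` qc J)) z) = 0)%E.
  move=> h; apply: esum1 => J [QJ JI]; rewrite patchE; case: ifPn => zJ; last by rewrite mule0.
  rewrite /= (_ : sqdiff f z = 0) ?mule0//; case: h => // -[].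
  by move: zJ; rewrite inE => -[/JI ? /JI ?]; split.
rewrite patchE; case: ifPn => [|/negP]; rewrite inE; last by move=> h; rewrite zero//; right.
case: z zero => x y /= zero [xI yI].
have [exy|xy] := eqVneq x y.
  rewrite zero; first by rewrite lee_fin mulr_ge0 ?qkernel_ge0// ltW// kernel_const_gt0.
  by left; rewrite /sqdiff exy subrr normr0 expr0n.
have dxy : 0 < `|x - y| by rewrite normr_gt0 subr_eq0.
pose M := ((`|x - y| ^+ n / Cd) `^ gamma)^-1.
have M0 : 0 <= M by rewrite invr_ge0 powR_ge0.
have Vgt0 J : dyadic Q J -> 0 < V J.
  by move=> QJ; apply: quasicube_volume_gt0; exact: dyadic_side_gt0 QJ.
pose S' := [set J | dyadic Q J /\ cube_set J (phi x) /\ V J `^ (- gamma) <= M].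
apply: (@le_trans _ _ (\esum_(J in S') (sqdiff f (x, y))%:E * (V J `^ (- gamma))%:E)%E).
  apply: le_esum_support => J.
    by move=> _; rewrite lee_fin mulr_ge0 ?sqdiff_ge0 ?powR_ge0.
  move=> [QJ JI]; rewrite patchE; case: ifPn; last by left; rewrite mule0.
  rewrite inE => -[/= xJ yJ]; right; split; last by rewrite muleC.
  split=> //; split=> //; rewrite powRN lef_pV2 ?posrE ?powR_gt0 ?(Vgt0 _ QJ)//; last first.
    by rewrite divr_gt0// exprn_gt0.
  have dn0 : 0 <= `|x - y| ^+ n / Cd.
    exact: divr_ge0 (exprn_ge0 _ (normr_ge0 _)) (ltW Cd0).
  apply: ge0_ler_powR; rewrite ?nnegrE ?dn0 ?(ltW gamma0) ?(ltW (Vgt0 _ QJ))//.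
  rewrite ler_pdivrMr// mulrC.
  by apply: quasicube_diam => //; exact: dyadic_side_gt0 QJ.
rewrite esumZl ?sqdiff_ge0//; last by move=> J _; rewrite lee_fin powR_ge0.
apply: (@le_trans _ _ ((sqdiff f (x, y))%:E * (M / (1 - theta))%:E)%E).
  rewrite lee_wpmul2l ?lee_fin ?sqdiff_ge0//.
  apply: le_dyadic_sum_through => //.
  - exact: dyadic_sub QI _ xI.
  - exact: chain_rate_bounds.
  - by move=> J _; exact: powR_ge0.
  - move=> I' J QI' IJ; have I0 := dyadic_side_gt0 Q0 QI'.
    have J0 : 0 < J.2 by rewrite (bisect_side IJ) divr_gt0.
    have VI0 := quasicube_volume_gt0 I0.
    have VJ0 := quasicube_volume_gt0 J0.
    rewrite !powRN ler_pdivlMr ?powR_gt0// ler_pdivrMl ?powR_gt0//.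
    rewrite -powRM ?subr_ge0 ?(ltW VI0) ?(ltW child_ratio_lt1)//.
    apply: ge0_ler_powR; rewrite ?nnegrE ?mulr_ge0 ?subr_ge0 ?(ltW VI0) ?(ltW VJ0)
      ?(ltW child_ratio_lt1) ?(ltW gamma0)//.
    have h := quasicube_child_le I0 IJ.
    by rewrite (mulrC (V I')).
rewrite -EFinM lee_fin /qkernel /kernel_const.
have /andP[_ t1] := chain_rate_bounds.
have t0 : 0 < 1 - theta by rewrite subr_gt0.
set g := sqdiff _ _; set P := _ / (1 - theta).
have E0 : 0 < enorm (x - y) by apply: lt_le_trans (norm_le_enorm _).
have Ep0 : 0 < enorm (x - y) `^ p by rewrite powR_gt0.
suff hM : M <= Cd `^ gamma * n%:R `^ p / enorm (x - y) `^ p.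
  rewrite [leRHS](_ : _ =
      g * (Cd `^ gamma * n%:R `^ p / enorm (x - y) `^ p / (1 - theta))); last first.
    by rewrite /P; field; rewrite !gt_eqF.
  by rewrite ler_wpM2l ?sqdiff_ge0// ler_pM2r ?invr_gt0.
have pE : p = n%:R * gamma by field; rewrite gt_eqF.
rewrite /M powRM ?exprn_ge0 ?invr_ge0 ?(ltW Cd0)// -[Cd^-1]powR_inv1 ?(ltW Cd0)//.
rewrite -powRrM mulN1r powRN invfM invrK -(powR_mulrn n (normr_ge0 (x - y)))
  -powRrM -pE mulrC -[X in _ <= X]mulrA.
rewrite ler_pM2l ?powR_gt0// ler_pdivlMr// ler_pdivrMl ?powR_gt0// -powRM//.
have p0 : 0 <= p by rewrite pE mulr_ge0// ltW.
by rewrite ge0_ler_powR ?nnegrE ?enorm_ge0 ?mulr_ge0// mulrC enorm_le_norm.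
Qed.

Section energy_bound.
Context (M : R).
Hypothesis M0 : 0 <= M.
Hypothesis energy_bound : forall P : cube R n, 0 < P.2 ->
  (qenergy f p (cube_set P) <= (M * P.2 `^ (n%:R * beta))%:E)%E.

Definition qosc_const : R := kernel_const * Cd `^ beta.

Lemma qosc_const_gt0 : 0 < qosc_const.
Proof. by rewrite mulr_gt0 ?powR_gt0 ?kernel_const_gt0. Qed.

(** The hypothesis concerns cubes; the quasicube is enclosed in its outer cube, of comparable
    volume. *)
Lemma qenergy_quasicube I : 0 < I.2 ->
  (qenergy f p (qc I) <= (M * (Cd `^ beta * V I `^ beta))%:E)%E.
Proof.
move=> I0; have D0 := quasicube_radius_gt0 I0.
have V0 := quasicube_volume_gt0 I0.
have O0 : 0 < 4 * (H * quasicube_radius I) by rewrite !mulr_gt0.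
have mq := measurable_quasicube I.
apply: (@le_trans _ _ (qenergy f p (cube_set (outer_cube I)))).
  apply: qenergy_subset => //; first exact: measurable_cube_set.
  exact: (outer_cube_sup).
apply: (le_trans (@energy_bound (outer_cube I) O0)).
rewrite lee_fin ler_wpM2l// powRrM powR_mulrn ?(ltW O0)//=.
rewrite -powRM ?(ltW V0) ?(ltW Cd0)//.
apply: ge0_ler_powR; rewrite ?nnegrE ?(ltW beta0) ?exprn_ge0 ?(ltW O0)//.
  by rewrite mulr_ge0 ?(ltW V0) ?(ltW Cd0).
exact: (outer_cube_volume).
Qed.

(** Since [beta - 2 = - gamma], the sum can be moved under the integral, where the kernel bound
    applies pointwise and leaves the energy on the quasicube of [I]. *)
Lemma qosc_sum Q I : 0 < Q.2 -> dyadic Q I ->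
  (\esum_(J in [set J | dyadic Q J /\ cube_set J `<=` cube_set I])
     ((V J `^ beta)%:E * qosc J) <= (qosc_const * M * V I `^ beta)%:E)%E.
Proof.
move=> Q0 QI; set S := [set J | _].
have I0 := dyadic_side_gt0 Q0 QI.
have mg J : measurable_fun setT ((EFin \o sqdiff f) \_ (qc J `*` qc J)).
  apply/(measurable_restrictT _ _).1.
    by apply: measurableX; exact: measurable_quasicube.
  by apply: measurable_funTS; apply: measurableT_comp => //; exact: measurable_sqdiff.
have g0 J z : (0 <= ((EFin \o sqdiff f) \_ (qc J `*` qc J)) z)%E.
  by apply: erestrict_ge0 => ? _; rewrite lee_fin sqdiff_ge0.
have mgJ J : measurable_fun setT (fun z => (V J `^ (- gamma))%:E *
      ((EFin \o sqdiff f) \_ (qc J `*` qc J)) z)%E by exact: measurable_funeM.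
have gJ0 J z : (0 <= (V J `^ (- gamma))%:E *
      ((EFin \o sqdiff f) \_ (qc J `*` qc J)) z)%E.
  by rewrite mule_ge0 ?lee_fin ?powR_ge0.
have cS : countable S by apply: sub_countable (countable_dyadic Q); apply: subset_card_le => J [].
rewrite (eq_esum (b := fun J => \int[mu2]_z ((V J `^ (- gamma))%:E *
      ((EFin \o sqdiff f) \_ (qc J `*` qc J)) z))%E); last first.
  move=> J [QJ _]; have J0 := dyadic_side_gt0 Q0 QJ.
  have V0 := quasicube_volume_gt0 J0.
  rewrite ge0_integralZl_EFin ?powR_ge0// -integral_mkcond /qosc muleA -EFinM.
  congr (_%:E * _)%E; rewrite -powR_invn ?(ltW V0)// -powRD; last by rewrite (lt0r_neq0 V0) implybT.
  by congr (_ `^ _); rewrite mulr2n; ring.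
rewrite -ge0_integral_esum//.
apply: (@le_trans _ _ (\int[mu2]_z
    ((fun z => (kernel_const * qkernel f p z)%:E) \_ (qc I `*` qc I)) z)%E).
  apply: ge0_le_integral => //.
  - by move=> z _; apply: esum_ge0 => J _.
  - by apply: emeasurable_fun_esum.
  - apply/(measurable_restrictT _ _).1.
      by apply: measurableX; exact: measurable_quasicube.
    apply: measurable_funTS; apply: measurableT_comp => //.
    by apply: measurable_funM => //; exact: measurable_qkernel.
  - by move=> z _; exact: quasicube_kernel_sum.
rewrite -integral_mkcond.
under eq_integral do rewrite EFinM.
rewrite ge0_integralZl_EFin ?(ltW kernel_const_gt0)//; last 3 first.
- by apply: measurableX; exact: measurable_quasicube.
- by move=> z _; rewrite lee_fin qkernel_ge0.
- by apply: measurable_funTS; apply: measurableT_comp => //; exact: measurable_qkernel.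
apply: (@le_trans _ _ (kernel_const%:E * (M * (Cd `^ beta * V I `^ beta))%:E)%E).
  by rewrite lee_wpmul2l ?lee_fin ?(ltW kernel_const_gt0)// qenergy_quasicube.
by rewrite -EFinM lee_fin le_eqVlt; apply/orP; left; apply/eqP; rewrite /qosc_const; ring.
Qed.

End energy_bound.

Section base_points.
Hypothesis qosc_fin : forall J, 0 < J.2 -> qosc J \is a fin_num.

Let mq J : measurable (qc J). Proof. exact: measurable_quasicube. Qed.

Let msq w : measurable_fun setT (fun y => (sqdiff f (w, y))%:E).
Proof.
apply: measurableT_comp => //; apply: measurable_funX; apply: measurableT_comp => //.
apply: measurable_funB => /=; first exact: measurable_cst.
exact: (continuous_measurable_rV f_cts).
Qed.

Let sq0 w y : (0 <= (sqdiff f (w, y))%:E)%E. Proof. by rewrite lee_fin sqdiff_ge0. Qed.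

(** The double integral in [qosc] is the integral of [g] over the quasicube; a point where [g] is at
    most its average is carried into [J] by [phi]. *)
Lemma exists_base_point J : 0 < J.2 -> exists2 z, cube_set J z &
  (\int[mu]_(y in qc J) (sqdiff f (psi z, y))%:E <= (V J * fine (qosc J))%:E)%E.
Proof.
move=> J0; have V0 := quasicube_volume_gt0 J0.
have muV := lebesgue_quasicube_fin J0.
pose g w := (\int[mu]_(y in qc J) (sqdiff f (w, y))%:E)%E.
have mg : measurable_fun setT g.
  pose F z := ((fun z => (sqdiff f z)%:E) \_ (setT `*` qc J)) z.
  have -> : g = fubini_F mu F.
    apply/funext => w; rewrite /g /fubini_F [LHS]integral_mkcond.
    by apply: eq_integral => y _; rewrite /F !patchE in_setX in_setT.
  apply: measurable_fun_fubini_tonelli_F.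
    apply/(measurable_restrictT _ _).1; first exact: measurableX.
    by apply: measurable_funTS; apply: measurableT_comp => //; exact: measurable_sqdiff.
  by move=> z; apply: erestrict_ge0 => ? _; rewrite lee_fin sqdiff_ge0.
have g0 w : (0 <= g w)%E by apply: integral_ge0.
have [w Jw] := exists_le_average (mq J) muV V0 (measurable_funTS mg) (fun w _ => g0 w).
rewrite /g (integral_setX _ _ (mq J) (mq J) (f := fun z => (sqdiff f z)%:E)); last 2 first.
- by apply: measurableT_comp => //; exact: measurable_sqdiff.
- by move=> z; rewrite lee_fin sqdiff_ge0.
move=> h; exists (phi w) => //; rewrite phiK EFinM (fineK (qosc_fin J0)).
rewrite /qosc muleA -EFinM [(V J * _)%R](_ : _ = (V J)^-1); last first.
  by field; rewrite gt_eqF.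
by rewrite -lee_pdivrMl ?invr_gt0// invrK.
Qed.

(* Values at these points replace averages: they converge to f o psi everywhere
   by continuity, and comparing both with f(y) for y in the smaller quasicube bounds
   the difference between a cube and its child. *)
Lemma exists_base_points : exists zz : cube R n -> 'rV[R]_n,
  (forall J, 0 < J.2 -> cube_set J (zz J)) /\
  forall I J, 0 < I.2 -> bisect I J ->
    (f (psi (zz I)) - f (psi (zz J))) ^+ 2 <=
      2 / child_ratio * fine (qosc I) + 2 / child_ratio * fine (qosc J).
Proof.
(* Cubes of nonpositive side receive the dummy point 0. *)
have /choice[zz zzP] J : exists z, 0 < J.2 -> cube_set J z /\
    (\int[mu]_(y in qc J) (sqdiff f (psi z, y))%:E <= (V J * fine (qosc J))%:E)%E.
  have [J0|J0] := pselect (0 < J.2); last by exists 0.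
  by have [z zJ hz] := exists_base_point J0; exists z.
exists zz; split=> [J /zzP[]//|I J I0 IJ].
have J0 : 0 < J.2 by rewrite (bisect_side IJ) divr_gt0.
have VI0 := quasicube_volume_gt0 I0.
have VJ0 := quasicube_volume_gt0 J0.
have muV := lebesgue_quasicube_fin J0.
have k0 := child_ratio_gt0.
have k1 := child_ratio_lt1.
have [_ hI] := zzP _ I0; have [_ hJ] := zzP _ J0.
set a := psi (zz I) in hI *; set b := psi (zz J) in hJ *.
have sub : qc J `<=` qc I by apply: preimage_subset; exact: bisect_sub.
have : ((V J * (f a - f b) ^+ 2)%:E <=
    2%:E * (V I * fine (qosc I))%:E + 2%:E * (V J * fine (qosc J))%:E)%E.
  apply: (@le_trans _ _ (\int[mu]_(y in qc J)
      (2%:E * (sqdiff f (a, y))%:E + 2%:E * (sqdiff f (b, y))%:E))%E).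
    rewrite mulrC EFinM -muV -integral_cst//.
    apply: ge0_le_integral => //.
    - by move=> y _; rewrite lee_fin sqr_ge0.
    - apply: emeasurable_funD; apply: measurable_funeM; exact: measurable_funTS.
    - move=> y _; rewrite -!EFinM -EFinD lee_fin /sqdiff !real_normK ?num_real//=.
      by have := sqr_ge0 (f a + f b - 2 * f y); lra.
  rewrite ge0_integralD//; last 4 first.
  - by move=> y _; rewrite mule_ge0.
  - by apply: measurable_funeM; exact: measurable_funTS.
  - by move=> y _; rewrite mule_ge0.
  - by apply: measurable_funeM; exact: measurable_funTS.
  rewrite !ge0_integralZl_EFin//; last 2 first.
  - exact: measurable_funTS.
  - exact: measurable_funTS.
  apply: leeD; rewrite lee_pmul2l//; apply: le_trans hI.
  by apply: ge0_subset_integral => //; exact: measurable_funTS.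
rewrite -!EFinM -EFinD lee_fin -ler_pdivlMl// => /le_trans; apply.
have sI : 0 <= fine (qosc I) by rewrite fine_ge0// qosc_ge0.
have sJ : 0 <= fine (qosc J) by rewrite fine_ge0// qosc_ge0.
rewrite mulrDr lerD//.
  (* The integral over [qc I] is divided by the smaller volume [V J]; the ratio [V I / V J] is at
     most [child_ratio^-1]. *)
  have -> : (V J)^-1 * (2 * (V I * fine (qosc I))) = 2 * (V I / V J) * fine (qosc I).
    by field; rewrite gt_eqF.
  rewrite ler_wpM2r// ler_pM2l// ler_pdivrMr// ler_pdivlMl//.
  exact: quasicube_child_ge.
rewrite mulrCA mulKf ?gt_eqF// ler_wpM2r// ler_pdivlMr// ler_piMr// ltW//.
Qed.

End base_points.

Hypothesis psi_cts : continuous psi.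

(** The factors stem, in order, from [qenergy_le_dyadic], the number of shifts, the base points
    together with [qosc_sum], the margin in the gauge, and the threefold side of the shifted
    cubes. *)
Definition composition_const : R :=
  chain_energy_const n alpha * #|{ffun 'I_n -> bool}|%:R *
  (2 / child_ratio * qosc_const) * 2 * (3 ^+ n) `^ beta.

Lemma composition_const_gt0 : 0 < composition_const.
Proof.
have k0 := child_ratio_gt0.
rewrite mulr_gt0 ?powR_gt0 ?exprn_gt0// mulr_gt0// mulr_gt0//.
  rewrite mulr_gt0 ?chain_energy_const_gt0// ltr0n card_ffun card_bool card_ord.
  by rewrite expn_gt0.
rewrite mulr_gt0 ?divr_gt0//.
exact: (qosc_const_gt0).
Qed.

Lemma Qnorm_comp_real (g M : R) :
  gauge phi beta = g%:E -> 0 <= M -> (Qnorm alpha f ^+ 2 <= M%:E)%E ->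
  (Qnorm alpha (f \o psi) ^+ 2 <= (composition_const * g * M)%:E)%E.
Proof.
move=> gE M0 fM.
have g1 : 1 <= g.
  rewrite -lee_fin -gE; exact: (gauge_ge1 beta n_gt0 quasicube_volume_gt0).
have Cg0 : 0 < composition_const * g.
  by rewrite mulr_gt0 ?composition_const_gt0// (lt_le_trans _ g1).
have u_cts : continuous (f \o psi).
  by move=> x; apply: continuous_comp; [exact: psi_cts|exact: f_cts].
apply: Qnorm_le_qenergy => // [|Q Q0]; first by rewrite mulr_ge0// ltW.
have hC := qosc_sum M0
  (fun P P0 => qenergy_le_Qnorm f_cts P0 fM).
have V0 := quasicube_volume_gt0.
(* [qosc_sum] with [Q = I = J], restricted to the term [J], bounds [qosc J]; this justifies the real
   values [fine (qosc J)] below. *)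
have qosc_fin J : 0 < J.2 -> qosc J \is a fin_num.
  move=> J0; rewrite ge0_fin_numE ?qosc_ge0//.
  have Vb : 0 < volume (qc J) `^ beta by rewrite powR_gt0 ?V0.
  have : ((volume (qc J) `^ beta)%:E * qosc J <=
      (qosc_const * M * volume (qc J) `^ beta)%:E)%E.
    apply: le_trans (hC _ _ J0 (dyadic_refl J)).
    apply: le_trans (esum_subset (A := [set J]) _ _); last first.
      by move=> _ ->; split=> //; exact: dyadic_refl.
    by rewrite esum_set1// mule_ge0 ?qosc_ge0// lee_fin powR_ge0.
  by rewrite -lee_pdivlMl// => /le_lt_trans; apply; rewrite -EFinM ltry.
have [zz [zz_in zz_child]] :=
  exists_base_points qosc_fin.
pose s J := 2 / child_ratio * fine (qosc J).
have k0 := child_ratio_gt0.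
have k20 : 0 <= 2 / child_ratio by rewrite divr_ge0// ltW.
have s0 J : 0 <= s J by rewrite mulr_ge0 ?fine_ge0 ?qosc_ge0.
apply: (le_trans (qenergy_le_dyadic n_gt0 alpha_gt0 u_cts (fun J _ => s0 J) zz_in zz_child Q0)).
have cec0 := chain_energy_const_gt0 n alpha_gt0.
have qc0 := qosc_const_gt0.
pose N : R := 2 / child_ratio * (qosc_const * M).
have N0 : 0 <= N by rewrite mulr_ge0// mulr_ge0// ltW.
pose B : R := N * (2 * g) * ((3 * Q.2) ^+ n) `^ beta.
apply: (@le_trans _ _ ((chain_energy_const n alpha)%:E *
    \sum_(t : {ffun 'I_n -> bool}) B%:E)%E).
  rewrite lee_wpmul2l ?lee_fin ?(ltW cec0)//; apply: lee_sum => t _.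
  have S0 : 0 < (shifted_cube Q t).2 by rewrite mulr_gt0.
  (* [gauge_transfer] asks for a strict bound, and [2 * g] exceeds [g] because [g >= 1]. *)
  have gt2 : (gauge_on phi beta (shifted_cube Q t) < (2 * g)%:E)%E.
    apply: (@le_lt_trans _ _ (gauge phi beta)).
      by apply: ereal_sup_ubound; exists (shifted_cube Q t).
    by rewrite gE lte_fin; lra.
  have hN I : dyadic (shifted_cube Q t) I ->
      (\esum_(J in [set J | dyadic (shifted_cube Q t) J /\ cube_set J `<=` cube_set I])
         (volume (qc J) `^ beta * s J)%:E <=
       (N * volume (qc I) `^ beta)%:E)%E.
    move=> QI; rewrite (eq_esum (b := fun J => (2 / child_ratio)%:E *
        ((volume (qc J) `^ beta)%:E * qosc J))%E); last first.
      move=> J [QJ _]; have J0 := dyadic_side_gt0 S0 QJ.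
      by rewrite -[in RHS](fineK (qosc_fin _ J0)) -!EFinM /s mulrCA.
    rewrite esumZl//; last first.
      by move=> J _; rewrite mule_ge0 ?qosc_ge0// lee_fin powR_ge0.
    have -> : N * volume (qc I) `^ beta =
        2 / child_ratio * (qosc_const * M * volume (qc I) `^ beta).
      by rewrite /N; ring.
    rewrite (EFinM (2 / child_ratio)) lee_wpmul2l ?lee_fin//.
    exact: hC.
  have := gauge_transfer V0 S0 (fun J _ => s0 J) N0 hN gt2.
  apply: le_trans; apply: le_esum => J QJ; have J0 := dyadic_side_gt0 S0 QJ.
  (* The exponent [n - 2 alpha] of the side equals [n * beta]. *)
  rewrite lee_fin ler_wpM2l// -powR_mulrn ?(ltW J0)// -powRrM le_eqVlt; apply/orP; left.
  by apply/eqP; congr (_ `^ _); field; rewrite pnatr_eq0 -lt0n.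
have -> : (\sum_(t : {ffun 'I_n -> bool}) B%:E)%E = (B * #|{ffun 'I_n -> bool}|%:R)%:E.
  rewrite sumEFin mulr_natr; congr (_%:E).
  by rewrite -sumr_const; apply: eq_bigl => t; rewrite inE.
rewrite -EFinM lee_fin /B /N /composition_const.
rewrite exprMn powRM ?exprn_ge0 ?(ltW Q0)//.
by rewrite le_eqVlt; apply/orP; left; apply/eqP; ring.
Qed.

Lemma Qnorm_comp (g : R) :
  gauge phi beta = g%:E ->
  (Qnorm alpha (f \o psi) ^+ 2 <=
    (composition_const * g)%:E * Qnorm alpha f ^+ 2)%E.
Proof.
move=> gE; apply: lee_mulr_of_real.
- rewrite mulr_gt0 ?composition_const_gt0// -lte_fin -gE.
  apply: lt_le_trans (gauge_ge1 beta n_gt0 quasicube_volume_gt0).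
  by rewrite lte_fin.
- exact: sqre_ge0.
- by move=> M; exact: Qnorm_comp_real.
Qed.

End quasicube.

(** * Capacities *)

Section homeomorphic_image.
Context (R : realType) (n : nat) (phi psi : 'rV[R]_n -> 'rV[R]_n).
Hypothesis phi_cts : continuous phi.
Hypothesis psi_cts : continuous psi.
Hypothesis phiK : cancel phi psi.
Hypothesis psiK : cancel psi phi.
Implicit Types (A K : set 'rV[R]_n).

Lemma image_preimage_inv A : phi @` A = psi @^-1` A.
Proof.
apply/seteqP; split=> [_ [x Ax <-]|x Ax]; first by rewrite /= phiK.
by exists (psi x).
Qed.

Lemma open_image A : open A -> open (phi @` A).
Proof. by move=> oA; rewrite image_preimage_inv; apply: open_comp => // x _; exact: psi_cts. Qed.

Lemma compact_image K : compact K -> compact (phi @` K).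
Proof. by apply: continuous_compact; exact: continuous_subspaceT. Qed.

(** The image of the closure is closed, being a preimage under [psi]; hence it contains the closure
    of the image, which is then a closed subset of a compact set. *)
Lemma compactly_contained_image A B : compactly_contained A B ->
  compactly_contained (phi @` A) (phi @` B).
Proof.
move=> [cA AB].
have sub : closure (phi @` A) `<=` phi @` closure A.
  rewrite [X in _ `<=` X]image_preimage_inv.
  have cl : closed (psi @^-1` closure A).
    by apply: preimage_closed; [move=> x _; exact: psi_cts|exact: closed_closure].
  rewrite [X in _ `<=` X](closure_id _).1//; apply: closureS => _ [x Ax <-] /=.
  by rewrite phiK; exact: subset_closure.
split; last by apply: (subset_trans sub); exact: image_subset.
apply: (subclosed_compact _ (compact_image cA) sub); exact: closed_closure.
Qed.

End homeomorphic_image.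

Section capacity_image.
Context (R : realType) (n : nat) (alpha c : R) (phi psi : 'rV[R]_n -> 'rV[R]_n).
Hypothesis phi_cts : continuous phi.
Hypothesis psi_cts : continuous psi.
Hypothesis phiK : cancel phi psi.
Hypothesis psiK : cancel psi phi.
Hypothesis c_gt0 : 0 < c.
Hypothesis Qnorm_comp_le : forall f : 'rV[R]_n -> R, continuous f ->
  (Qnorm alpha (f \o psi) ^+ 2 <= c%:E * Qnorm alpha f ^+ 2)%E.
Implicit Types (K O E Omega : set 'rV[R]_n).

Lemma Cc_comp Omega f : Cc Omega f -> Cc (phi @` Omega) (f \o psi).
Proof.
move=> [f_cts fO]; split.
  by move=> x; apply: continuous_comp; [exact: psi_cts|exact: f_cts].
have -> : [set x | (f \o psi) x != 0] = phi @` [set x | f x != 0].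
  by rewrite (image_preimage_inv phiK psiK).
exact: (compactly_contained_image phi_cts psi_cts phiK psiK).
Qed.

Lemma cap_compact_image K Omega :
  (cap_compact alpha (phi @` K) (phi @` Omega) <= c%:E * cap_compact alpha K Omega)%E.
Proof.
rewrite -lee_pdivrMl//; apply: le_ereal_inf_tmp => _ [f [fO fK] <-].
rewrite lee_pdivrMl//; apply: le_trans (Qnorm_comp_le _); last by case: fO.
apply: ereal_inf_lbound; exists (f \o psi) => //; split; first exact: Cc_comp.
by move=> _ [x Kx <-] /=; rewrite phiK; exact: fK.
Qed.

Lemma cap_open_image O Omega :
  (cap_open alpha (phi @` O) (phi @` Omega) <= c%:E * cap_open alpha O Omega)%E.
Proof.
apply: ge_ereal_sup => _ [K [cK KO] <-].
(* A compact subset of the image of [O] is itself the image of the compact subset psi(K) of [O], so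
   the bound for compact sets applies. *)
have -> : K = phi @` (psi @` K).
  apply/seteqP; split=> [x Kx|_ [_ [x Kx <-] <-]]; last by rewrite psiK.
  by exists (psi x) => //; exists x.
apply: (le_trans (cap_compact_image _ _)); rewrite lee_pmul2l//.
apply: ereal_sup_ubound; exists (psi @` K) => //; split.
  exact: (compact_image psi_cts).
by move=> _ [x /KO [y Oy <-] <-]; rewrite phiK.
Qed.

Lemma cap_image E Omega :
  (cap alpha (phi @` E) (phi @` Omega) <= c%:E * cap alpha E Omega)%E.
Proof.
rewrite -lee_pdivrMl//; apply: le_ereal_inf_tmp => _ [U [oU EU cU] <-].
rewrite lee_pdivrMl//; apply: le_trans (cap_open_image _ _).
apply: ereal_inf_lbound; exists (phi @` U) => //; split.
- exact: (open_image psi_cts phiK psiK).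
- exact: image_subset.
- exact: (compactly_contained_image phi_cts psi_cts phiK psiK).
Qed.

End capacity_image.

Lemma cap_ge0 (R : realType) (n : nat) (alpha : R) (E Omega : set 'rV[R]_n) :
  (0 <= cap alpha E Omega)%E.
Proof.
apply: le_ereal_inf_tmp => _ [U _ <-].
apply: le_trans (ereal_sup_ubound _); last first.
  by exists set0 => //; split=> //; exact: compact0.
by apply: le_ereal_inf_tmp => _ [f _ <-]; exact: sqre_ge0.
Qed.

Theorem theorem6p4 (R : realType) (n : nat) (alpha : R) (eta : R -> R)
    (A B : \bar R)
    (n_gt0 : (0 < n)%N) (halpha : 0 < alpha < Num.min 1 (n%:R / 2)) :
  exists C : R, 0 < C /\
    forall phi psi : 'rV[R]_n -> 'rV[R]_n,
      quasisymmetric eta phi psi ->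
      (n = 1%N -> Jac_Ainfty phi /\ Jac_Ainfty psi) ->
      Ainfty_const (Jac phi) = A -> Ainfty_const (Jac psi) = B ->
      (forall Omega E : set 'rV[R]_n,
         open Omega -> precompact Omega -> compactly_contained E Omega ->
         (cap alpha (phi @` E) (phi @` Omega) <=
            if gauge phi (1 - 2 * alpha / n%:R) == +oo then +oo
            else C%:E * gauge phi (1 - 2 * alpha / n%:R) * cap alpha E Omega)%E)
      /\
      ((gauge phi (1 - 2 * alpha / n%:R) < +oo)%E ->
       forall Omega E : set 'rV[R]_n,
         open Omega -> precompact Omega -> compactly_contained E Omega ->
         removable alpha E Omega ->
         removable alpha (phi @` E) (phi @` Omega)).
Proof.
move: halpha; rewrite lt_min => /andP[alpha_gt0 /andP[_ alpha_lt]].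
(* Unless [eta] is an increasing homeomorphism, no map is [eta]-quasisymmetric and any constant
   serves. *)
have [ih|nih] := pselect (increasing_homeo eta); last first.
  by exists 1; split=> // phi psi [_ ih]; case: nih.
have [H H1 wqs] := quasisymmetric_inv n_gt0 ih.
have C_gt0 := composition_const_gt0 n_gt0 H1 alpha_gt0.
(* [H] was obtained from [n] and [eta], so the constant is fixed before [phi] and [psi]. *)
exists (composition_const n H alpha); split=> // phi psi qs _ _ _.
have [[phiK psiK phi_cts psi_cts] _ _] := qs.
have psi_wqs := wqs _ _ qs.
set G := gauge phi _.
have main : (G < +oo)%E -> forall Omega E : set 'rV[R]_n,
    (cap alpha (phi @` E) (phi @` Omega) <=
      (composition_const n H alpha)%:E * G * cap alpha E Omega)%E.
  move=> Goo Omega E.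
  (* A gauge of at least 1 makes the factor positive, as [cap_image] requires. *)
  have G1 : (1 <= G)%E := gauge_ge1 _ n_gt0
    (fun J sJ => quasicube_volume_gt0 n_gt0 phi_cts phiK psiK H1 psi_wqs sJ).
  have Gfin : G \is a fin_num by rewrite ge0_fin_numE// (le_trans _ G1).
  have g1 : 1 <= fine G by rewrite -lee_fin fineK.
  rewrite -(fineK Gfin) -EFinM.
  apply: (cap_image phi_cts psi_cts phiK psiK).
    by rewrite mulr_gt0// (lt_le_trans _ g1).
  move=> f f_cts.
  apply: (Qnorm_comp n_gt0 phi_cts phiK psiK H1 psi_wqs alpha_gt0 alpha_lt f_cts psi_cts) => //.
  by rewrite fineK.
split=> [|Goo] Omega E _ _ => [_|EO [_ cap0]].
  by case: eqP => [_|/eqP]; [exact: leey|rewrite -ltey => /main].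
split; first exact: (compactly_contained_image phi_cts psi_cts phiK psiK).
apply/eqP; rewrite eq_le cap_ge0 andbT.
by apply: (le_trans (main Goo _ _)); rewrite cap0 mule0.
Qed.
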